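(* Let $r>0$ be the access point (AP) range, and let a stochastic environment be represented by $T\ge 1$ layout realizations $\mathcal{L}^{(1)},\dots,\mathcal{L}^{(T)}$. For each $t$, let $p_1^{(t)},\dots,p_{M^{(t)}}^{(t)}$ be the triangles of a hyper-triangulation $\mathcal{HT}(R,\mathcal{L}^{(t)})$, where the parameter $R$ is admissible (as defined in the context), and let $\mathcal{G}$ be the corresponding Partition-based Visibility (PV) graph. Suppose the nodes of $\mathcal{G}$ are partitioned into $g$ cliques $c_1,c_2,\dots,c_g$ such that $\mathcal{V}_r(c_j)\neq\emptyset$ for $j=1,2,\dots,g$. Then deploying $g$ APs, with one placed at an arbitrary point of each $\mathcal{V}_r(c_j)$, ensures line-of-sight (LoS) coverage of the environment across all realizations. That is, for any choice of points $X_j\in\mathcal{V}_r(c_j)$, $j=1,\dots,g$, and for every $t\in\{1,\dots,T\}$ and every point $Q$ of $\mathcal{L}^{(t)}$, there is some $j$ such that $X_j$ lies in the visibility area $\mathcal{V}_r(Q)$ of $Q$ computed in $\mathcal{L}^{(t)}$.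
   Context: Layout: a layout $\mathcal{L}$ is a planar region bounded by a polygon (the walls), from which finitely many (possibly zero) polygonal obstacles are removed; boundary points of walls and obstacles count as points of the layout. Realizations $\mathcal{L}^{(1)},\dots,\mathcal{L}^{(T)}$ have the same walls and the same obstacles in shape and size; only the obstacle locations vary. Visibility area of a point: for a point $P$ in a layout and $r>0$, $\mathcal{V}_r(P)$ is the set of all points $Y$ such that the segment $PY$ lies entirely inside the layout (no layout edge or obstacle blocks it) and $\|PY\|\le r$. Visibility area of a polygon: for a polygon $p$ in a layout with vertices $P_1,\dots,P_l$, $\mathcal{V}_r(p)=\bigcap_{i=1}^{l}\mathcal{V}_r(P_i)$. For a triangle $p_i^{(t)}$ of the $t$-th realization, visibility is computed in $\mathcal{L}^{(t)}$. Visibility area of a set of polygons: for $c=\{p_1,\dots,p_k\}$ (possibly from different realizations), $\mathcal{V}_r(c)=\bigcap_{i=1}^{k}\mathcal{V}_r(p_i)$. Hyper-triangulation $\mathcal{HT}(R,\mathcal{L})$: start with a triangulation of $\mathcal{L}$ (a partition into triangles by non-crossing diagonals between vertices of walls and obstacles), and repeatedly divide triangles by connecting the midpoint of the largest side of a triangle to its opposite vertex, until no triangle has a side longer than $R$. Inradius of the convex hull (IRCH): for an obstacle, the radius of the largest disc contained in its convex hull. For obstacles $1,\dots,b$ with IRCH values $\delta_1,\dots,\delta_b$, $\delta_{\min}=\min(\delta_1,\dots,\delta_b)$. Admissible $R$: $0<R\le r$ (hence also $R\le\sqrt{3}\,r$), and in addition, if there are obstacles and $\delta_{\min}\le\frac{\sqrt3}{6}r$,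 then $R\le 2x^*$, where $x^*$ is the smallest positive real root of $f(x)=x^3-rx^2+\delta_{\min}^2x+\delta_{\min}^2r$. PV graph: the simple unweighted graph whose nodes are all triangles $p_i^{(t)}$, $1\le t\le T$, $1\le i\le M^{(t)}$, with two different nodes $p_i^{(t)}$ and $p_j^{(t')}$ adjacent if and only if $\mathcal{V}_r(p_i^{(t)})\cap\mathcal{V}_r(p_j^{(t')})\neq\emptyset$. *)

(* Defs.v *)
(* MathComp / MathComp-Analysis development, over an arbitrary K : realType. *)
From HB Require Import structures.
From mathcomp Require Import all_boot all_order all_algebra.
From mathcomp Require Import all_classical all_reals all_analysis.

Set Implicit Arguments.
Unset Strict Implicit.
Unset Printing Implicit Defensive.

Import Order.TTheory GRing.Theory Num.Theory.
Import numFieldNormedType.Exports.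

Local Open Scope classical_set_scope.
Local Open Scope ring_scope.

Section Plane.
Variable K : realType.

(* The library norm on K * K is the sup norm (it only provides the topology
   here), hence an explicit Euclidean distance. *)
Definition edist (P Q : K * K) : K :=
  Num.sqrt ((P.1 - Q.1) ^+ 2 + (P.2 - Q.2) ^+ 2).

Definition lin (P Q : K * K) (t : K) : K * K := (1 - t) *: P + t *: Q.

Definition segment (P Q : K * K) : set (K * K) :=
  [set lin P Q t | t in [set t : K | 0 <= t <= 1]].

Definition half_open_segment (P Q : K * K) : set (K * K) :=
  [set lin P Q t | t in [set t : K | 0 <= t < 1]].

Definition open_segment (P Q : K * K) : set (K * K) :=
  [set lin P Q t | t in [set t : K | 0 < t < 1]].

Definition midpoint (P Q : K * K) : K * K := lin P Q 2^-1.

Definition conv_hull (A : set (K * K)) : set (K * K) :=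
  smallest (@convex_set K (K * K)%type) A.

Definition closed_disc (c : K * K) (rho : K) : set (K * K) :=
  [set x | edist c x <= rho].

(* A polygon is the cyclic sequence of its vertices. *)
Definition next_vertex (s : seq (K * K)) (i : nat) : K * K :=
  s`_(i.+1 %% size s)%N.

Definition boundary (s : seq (K * K)) : set (K * K) :=
  \bigcup_(i in [set i | (i < size s)%N]) segment s`_i (next_vertex s i).

(* Disjointness of the half-open edges says that the closed curve running
   through the vertices is injective: distinct vertices, and no two edges meet
   except consecutive ones at their common vertex. *)
Definition simple_polygon (s : seq (K * K)) : Prop :=
  (3 <= size s)%N /\
  forall i j, (i < j < size s)%N ->
    half_open_segment s`_i (next_vertex s i) `&`
    half_open_segment s`_j (next_vertex s j) = set0.

(* The bounded part of the complement of the boundary curve. *)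
Definition inside (s : seq (K * K)) : set (K * K) :=
  [set x | ~ boundary s x /\
           bounded_set (connected_component (~` boundary s) x)].

Definition solid (s : seq (K * K)) : set (K * K) := boundary s `|` inside s.

Definition congruent (s s' : seq (K * K)) : Prop :=
  exists phi : K * K -> K * K,
    (forall x y, edist (phi x) (phi y) = edist x y) /\ s' = map phi s.

(* [b] is the number of obstacles, possibly 0. *)
Record layout (b : nat) := Layout {
  walls : seq (K * K);
  obstacle : 'I_b -> seq (K * K) }.

(* Obstacles may touch the walls and one another; since they lie in the walled
   region and do not overlap, all boundary points of walls and obstacles belong
   to [region]. *)
Definition wf_layout b (L : layout b) : Prop :=
  [/\ simple_polygon (walls L),
      forall k, simple_polygon (obstacle L k),
      forall k, solid (obstacle L k) `<=` solid (walls L) &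
      forall k l, k != l ->
        inside (obstacle L k) `&` inside (obstacle L l) = set0].

Definition region b (L : layout b) : set (K * K) :=
  solid (walls L) `\` \bigcup_k inside (obstacle L k).

Definition layout_vertex b (L : layout b) (P : K * K) : Prop :=
  P \in walls L \/ exists k, P \in obstacle L k.

Definition realizations b T (L : 'I_T -> layout b) : Prop :=
  (forall t, wf_layout (L t)) /\
  forall t t', walls (L t) = walls (L t') /\
    forall k, congruent (obstacle (L t) k) (obstacle (L t') k).

Definition vis_point b (L : layout b) (r : K) (P : K * K) : set (K * K) :=
  [set Y | segment P Y `<=` region L /\ edist P Y <= r].

Definition vis_poly b (L : layout b) (r : K) (p : seq (K * K)) :
    set (K * K) :=
  \bigcap_(P in [set` p]) vis_point L r P.

Definition triangle : Type := 3.-tuple (K * K).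

Definition tri_region (p : triangle) : set (K * K) := conv_hull [set` p].

Definition nondegenerate (p : triangle) : Prop :=
  let: (A, B, C) := (p`_0, p`_1, p`_2) in
  (B.1 - A.1) * (C.2 - A.2) - (B.2 - A.2) * (C.1 - A.1) != 0.

Definition is_side (p : triangle) (A B : K * K) : Prop :=
  [/\ A \in p, B \in p & A != B].

Definition triangulation b (L : layout b) (ts : seq triangle) : Prop :=
  [/\ forall p, p \in ts ->
        nondegenerate p /\ (forall P, P \in p -> layout_vertex L P),
      region L = \bigcup_(p in [set` ts]) tri_region p,
      forall i j, (i < j < size ts)%N ->
        (tri_region (nth [tuple of nseq 3 0] ts i))° `&`
        (tri_region (nth [tuple of nseq 3 0] ts j))° = set0 &
      forall p q A B C D, p \in ts -> q \in ts ->
        is_side p A B -> is_side q C D ->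
        segment A B = segment C D \/
        open_segment A B `&` open_segment C D = set0].

(* One triangle of [ts] is cut along the median of a longest side AB; the order
   in which triangles (and vertices of a triangle) are listed is immaterial. *)
Definition bisection (ts ts' : seq triangle) : Prop :=
  exists (p : triangle) (us : seq triangle) (A B C : K * K),
    [/\ perm_eq ts (p :: us),
        perm_eq p [:: A; B; C],
        forall P Q, P \in p -> Q \in p -> edist P Q <= edist A B &
        perm_eq ts' [:: [tuple A; midpoint A B; C],
                        [tuple midpoint A B; B; C] & us]].

Inductive iter_bisection : seq triangle -> seq triangle -> Prop :=
| IterBisection0 ts : iter_bisection ts ts
| IterBisectionS ts us vs :
    iter_bisection ts us -> bisection us vs -> iter_bisection ts vs.

Definition hyper_triangulation (R : K) b (L : layout b) (ts : seq triangle) :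
    Prop :=
  exists ts0, [/\ triangulation L ts0, iter_bisection ts0 ts &
    forall p, p \in ts ->
      forall P Q, P \in p -> Q \in p -> edist P Q <= R].

Definition is_irch (s : seq (K * K)) (delta : K) : Prop :=
  [/\ 0 <= delta,
      exists c, closed_disc c delta `<=` conv_hull (solid s) &
      forall c rho, 0 <= rho -> closed_disc c rho `<=` conv_hull (solid s) ->
        rho <= delta].

Definition is_min b (delta : 'I_b -> K) (m : K) : Prop :=
  (exists k, delta k = m) /\ forall k, m <= delta k.

Definition bound_poly (r d : K) : {poly K} :=
  'X^3 - r *: 'X^2 + d ^+ 2 *: 'X + (d ^+ 2 * r)%:P.

Definition smallest_pos_root (f : {poly K}) (x : K) : Prop :=
  [/\ 0 < x, root f x & forall y, 0 < y -> root f y -> x <= y].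

(* When b = 0 there is no minimum and the last clause is void. *)
Definition admissible (r : K) b (delta : 'I_b -> K) (R : K) : Prop :=
  [/\ 0 < R, R <= r &
      forall dmin, is_min delta dmin -> dmin <= Num.sqrt 3 / 6 * r ->
        exists2 x, smallest_pos_root (bound_poly r dmin) x & R <= 2 * x].

End Plane.

(* The node (t, i) stands for the i-th triangle of the t-th realization. *)
Definition pv_node T (M : 'I_T -> nat) : finType := {t : 'I_T & 'I_(M t)}.

Section PVGraph.
Variables (K : realType) (b T : nat) (L : 'I_T -> layout K b) (r : K).
Variables (M : 'I_T -> nat) (p : forall t, (M t).-tuple (triangle K)).

Definition node_vis (v : pv_node M) : set (K * K) :=
  vis_poly (L (tag v)) r (tnth (p (tag v)) (tagged v)).

Definition nodes_vis (c : {set pv_node M}) : set (K * K) :=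
  \bigcap_(v in [set` c]) node_vis v.

Definition pv_edge : rel (pv_node M) :=
  fun u v => (u != v) && `[< node_vis u `&` node_vis v !=set0 >].

End PVGraph.

Definition clique (V : finType) (e : rel V) (c : {set V}) : Prop :=
  {in c &, forall u v, u != v -> e u v}.

Definition partitioned_by (V : finType) g (c : 'I_g -> {set V}) : Prop :=
  injective c /\ finset.partition (c @: finset.setT)%SET finset.setT.

(* Main.v *)
(* Let [X] be within range of the vertices of a triangle [ABC] of the hyper-
   triangulation and see all three, and let [y] lie on a segment from [ABC] to
   [X]. Outside [ABC], [y] lies in a triangle [D] with apex [X] whose perimeter
   consists of points of the layout, whose legs are at most [r], one of them
   strictly, and whose base is at most [R].
   If [y] were outside the walls, its component in the complement of the walls
   would be unbounded but trapped in [D]. If [y] were inside an obstacle, the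
   component of [y] in the complement of the obstacle's boundary would be trapped
   in [D]; by connectedness the whole boundary lies in the closure of that
   component (at each point the boundary is locally two rays, whose complement
   has two pieces, each adherent to both rays; no Jordan curve theorem is
   needed). Hence the hull of the obstacle, and with it a disc of radius
   [delta_min], fits in [D]. Heron's formula then makes the cubic
   [x^3 - r x^2 + delta_min^2 x + delta_min^2 r] negative at half the base of [D],
   contrary to the admissibility of [R]. *)
Require Import Defs.
From HB Require Import structures.
From mathcomp Require Import all_boot all_order all_algebra.
From mathcomp Require Import all_classical all_reals all_analysis.
From mathcomp Require Import ring lra zify.

Set Implicit Arguments.
Unset Strict Implicit.
Unset Printing Implicit Defensive.

Import Order.TTheory GRing.Theory Num.Theory.
Import numFieldNormedType.Exports.

Local Open Scope classical_set_scope.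
Local Open Scope ring_scope.

(* all_analysis exports other constants named [edist] and [nondegenerate]. *)
Local Notation edist := Defs.edist.
Local Notation nondegenerate := Defs.nondegenerate.

(** * Segments, triangles and signed areas *)

Section PlaneConvexity.
Variable K : realType.
Implicit Types (P Q X Y A B C z : K * K) (S D : set (K * K)).

Lemma point_eq P Q : P.1 = Q.1 -> P.2 = Q.2 -> P = Q.
Proof. by case: P Q => p1 p2 [q1 q2] /= -> ->. Qed.

Lemma lin0 P Q : lin P Q 0 = P.
Proof. by rewrite /lin subr0 scale1r scale0r addr0. Qed.

Lemma lin1 P Q : lin P Q 1 = Q.
Proof. by rewrite /lin subrr scale0r scale1r add0r. Qed.

Lemma linC P Q t : lin P Q t = lin Q P (1 - t).
Proof. by apply: point_eq => /=; rewrite /GRing.scale /=; ring. Qed.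

Lemma segment_l P Q : segment P Q P.
Proof. by exists 0; [rewrite /= lexx ler01 | exact: lin0]. Qed.

Lemma segment_r P Q : segment P Q Q.
Proof. by exists 1; [rewrite /= lexx ler01 | exact: lin1]. Qed.

Lemma segmentC P Q : segment P Q = segment Q P.
Proof.
suff sub A B : segment A B `<=` segment B A by apply/seteqP; split; exact: sub.
by move=> _ [t /andP[t0 t1] <-]; exists (1 - t); [apply/andP; split; lra|rewrite -linC].
Qed.

(** Convexity stated with [segment], the form in which visibility speaks; [conv_hull_min] and
    [conv_hull_convex] translate from and to [convex_set]. *)
Definition seg_convex S := forall x y, S x -> S y -> segment x y `<=` S.

Lemma segment_seg_convex A B : seg_convex (segment A B).
Proof.
move=> _ _ [p p01 <-] [q q01 <-] _ [l l01 <-].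
exists ((1 - l) * p + l * q).
  move: p01 q01 l01 => /andP[p0 p1] /andP[q0 q1] /andP[l0 l1].
  by apply/andP; split; nra.
by apply: point_eq; rewrite /= /GRing.scale /=; ring.
Qed.

Lemma conv_hull_min S D : seg_convex D -> S `<=` D -> conv_hull S `<=` D.
Proof.
move=> cD SD; apply: smallest_sub => //.
move=> x y l; rewrite !inE => Dx Dy.
(* The library's convex combination puts the parameter on the first point, [lin] on the second. *)
apply: (cD x y Dx Dy); exists (1 - l%:num).
  have /andP[l0 l1] : 0 <= l%:num <= 1 by rewrite ge0 le1.
  by apply/andP; split; lra.
by rewrite /lin subKr.
Qed.

Lemma conv_hull_convex S : seg_convex (conv_hull S).
Proof.
move=> x y Sx Sy _ [t /andP[t0 t1] <-] D [cD SD].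
have := cD x y (Itv01 (ltac:(lra) : 0 <= 1 - t) (ltac:(lra) : 1 - t <= 1)).
rewrite !inE => /(_ (Sx D (conj cD SD)) (Sy D (conj cD SD))).
by rewrite /conv/= /unstable.onem subKr.
Qed.

Lemma sub_conv_hull S : S `<=` conv_hull S.
Proof. by move=> x Sx D [_ ]; exact. Qed.

(** The closed triangle in barycentric coordinates, apex [X] first; degenerate triangles are
    allowed. *)
Definition tri_set X A B : set (K * K) :=
  [set y | exists t a b, [/\ 0 <= t, 0 <= a, 0 <= b, t + a + b = 1 &
    y = t *: X + a *: A + b *: B]].

Lemma tri_set_convex X A B : seg_convex (tri_set X A B).
Proof.
move=> _ _ [t [a [b [t0 a0 b0 e ->]]]] [t' [a' [b' [t0' a0' b0' e' ->]]]] _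
  [l /andP[l0 l1] <-].
exists ((1 - l) * t + l * t'), ((1 - l) * a + l * a'), ((1 - l) * b + l * b').
split; try by rewrite addr_ge0 // mulr_ge0 //; lra.
  have -> : (1 - l) * t + l * t' + ((1 - l) * a + l * a') +
    ((1 - l) * b + l * b') = (1 - l) * (t + a + b) + l * (t' + a' + b') by ring.
  by rewrite e e'; ring.
by apply: point_eq => /=; rewrite /GRing.scale /=; ring.
Qed.

Lemma tri_set1 X A B : tri_set X A B X.
Proof.
exists 1, 0, 0; rewrite lexx ler01; split=> //; first by rewrite !addr0.
by rewrite scale1r !scale0r !addr0.
Qed.

Lemma tri_setC X A B : tri_set X A B `<=` tri_set X B A.
Proof.
move=> y [t [a [b [t0 a0 b0 e ->]]]]; exists t, b, a; split => //; first by rewrite addrAC.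
by rewrite addrAC.
Qed.

Lemma tri_setR X A B : tri_set X A B `<=` tri_set A B X.
Proof.
move=> y [t [a [b [t0 a0 b0 e ->]]]]; exists a, b, t; split => //.
  by rewrite -e addrC addrA.
by rewrite [RHS]addrC addrA.
Qed.

Lemma tri_set2 X A B : tri_set X A B A.
Proof. by do 2 apply: tri_setR; exact: tri_set1. Qed.

Lemma tri_set3 X A B : tri_set X A B B.
Proof. by apply: tri_setR; exact: tri_set1. Qed.

(** A point of the triangle lies on the segment from [X] to the point of [AB] with parameter
    [b / (a + b)], so convexity is used twice; when [a + b = 0] the point is [X]. *)
Lemma tri_set_min X A B D : seg_convex D -> D X -> D A -> D B ->
  tri_set X A B `<=` D.
Proof.
move=> cD DX DA DB y [t [a [b [t0 a0 b0 e ->]]]].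
have [ab0|abn0] := eqVneq (a + b) 0.
  have a00 : a = 0 by lra.
  have b00 : b = 0 by lra.
  have t10 : t = 1 by lra.
  by rewrite a00 b00 t10 scale1r !scale0r !addr0.
have ab_gt0 : 0 < a + b by rewrite lt_def abn0 addr_ge0.
have DAB : D (lin A B (b / (a + b))).
  apply: (cD A B DA DB); exists (b / (a + b)) => //; apply/andP; split.
    by rewrite divr_ge0 // ltW.
  by rewrite ler_pdivrMr // mul1r; lra.
apply: (cD _ _ DX DAB); exists (a + b); first by apply/andP; split; lra.
have -> : t = 1 - (a + b) by lra.
by apply: point_eq => /=; rewrite /GRing.scale /=; field.
Qed.

Lemma tri_regionE (p : triangle K) (A B C : K * K) : p =i [:: A; B; C] ->
  tri_region p = tri_set A B C.
Proof.
move=> memp; apply/seteqP; split.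
  apply: conv_hull_min; first exact: tri_set_convex.
  move=> P /=; rewrite memp !inE => /or3P[] /eqP ->.
  - exact: tri_set1.
  - exact: tri_set2.
  - exact: tri_set3.
apply: tri_set_min; first exact: conv_hull_convex.
all: by apply: sub_conv_hull; rewrite /= memp !inE eqxx ?orbT.
Qed.

(** Twice the signed area of the triangle [PQY]: affine in [Y], positive to the left of the line
    from [P] to [Q]. *)
Definition orient P Q Y : K :=
  (Q.1 - P.1) * (Y.2 - P.2) - (Q.2 - P.2) * (Y.1 - P.1).

Lemma orient_lin P Q Y Y' t :
  orient P Q (lin Y Y' t) = (1 - t) * orient P Q Y + t * orient P Q Y'.
Proof. by rewrite /orient /lin /= /GRing.scale /=; ring. Qed.

Lemma orient_comb P Q X A B t a b : t + a + b = 1 ->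
  orient P Q (t *: X + a *: A + b *: B) =
  t * orient P Q X + a * orient P Q A + b * orient P Q B.
Proof.
by move=> e; have -> : t = 1 - a - b by [lra]; rewrite /orient /= /GRing.scale /=; ring.
Qed.

Lemma orient_rot A B X : orient A B X = orient B X A.
Proof. by rewrite /orient; ring. Qed.

Lemma orient_swap A B X : orient B A X = - orient A B X.
Proof. by rewrite /orient; ring. Qed.

(** Cramer's rule: barycentric coordinates are ratios of signed areas. *)
Lemma orient_barycentric A B C Y : orient A B C != 0 ->
  Y = (orient B C Y / orient A B C) *: A + (orient C A Y / orient A B C) *: B +
      (orient A B Y / orient A B C) *: C.
Proof.
case: A B C Y => [a1 a2] [b1 b2] [c1 c2] [y1 y2]; rewrite /orient /= => n0.
by apply: point_eq; rewrite /= /GRing.scale /=; field.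
Qed.

Lemma orient_sum A B C Y :
  orient B C Y + orient C A Y + orient A B Y = orient A B C.
Proof. by rewrite /orient; ring. Qed.

(** Barycentric coordinates being area ratios, a positively oriented triangle is an intersection of
    three half-planes; its closedness and its interior are read off from this. *)
Lemma tri_set_orient X A B y : 0 < orient A B X ->
  tri_set X A B y <->
  [/\ 0 <= orient A B y, 0 <= orient B X y & 0 <= orient X A y].
Proof.
move=> o0; split.
  move=> [t [a [b [t0 a0 b0 e ->]]]]; rewrite !orient_comb //.
  have o2 : orient B X A = orient A B X by rewrite /orient; ring.
  have o3 : orient X A B = orient A B X by rewrite /orient; ring.
  have z P Q : orient P Q P = 0 by rewrite /orient; ring.
  have z' P Q : orient P Q Q = 0 by rewrite /orient; ring.
  by rewrite !z !z' o2 o3 !mulr0 !addr0 !add0r !mulr_ge0 // ltW.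
move=> [oy1 oy2 oy3].
have n0 : orient A B X != 0 by rewrite gt_eqF.
have sumE : orient A B y + orient B X y + orient X A y = orient A B X.
  by rewrite /orient; ring.
exists (orient A B y / orient A B X), (orient B X y / orient A B X),
  (orient X A y / orient A B X).
split; try by rewrite divr_ge0 // ltW.
  by rewrite -!mulrDl sumE divff.
by rewrite {1}(@orient_barycentric A B X y n0) [LHS]addrC addrA.
Qed.

End PlaneConvexity.

(** * Distances, inscribed discs and the cubic bound *)

Section Metric.
Variable K : realType.
Implicit Types (P Q X Y A B C c : K * K) (r R rho d x : K).

Lemma edist_ge0 P Q : 0 <= edist P Q.
Proof. exact: sqrtr_ge0. Qed.

Lemma edist_sqr P Q :
  edist P Q ^+ 2 = (P.1 - Q.1) ^+ 2 + (P.2 - Q.2) ^+ 2.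
Proof. by rewrite sqr_sqrtr // addr_ge0 // sqr_ge0. Qed.

Lemma edistC P Q : edist P Q = edist Q P.
Proof. by rewrite /edist; congr Num.sqrt; ring. Qed.

Lemma edist_le P Q r : 0 <= r ->
  (edist P Q <= r) = ((P.1 - Q.1) ^+ 2 + (P.2 - Q.2) ^+ 2 <= r ^+ 2).
Proof. by move=> r0; rewrite -edist_sqr ler_pXn2r // nnegrE edist_ge0. Qed.

Lemma edist_lt P Q r : 0 <= r ->
  (edist P Q < r) = ((P.1 - Q.1) ^+ 2 + (P.2 - Q.2) ^+ 2 < r ^+ 2).
Proof. by move=> r0; rewrite -edist_sqr ltr_pXn2r // nnegrE edist_ge0. Qed.

Lemma edist_gt0 P Q : P != Q -> 0 < edist P Q.
Proof.
move=> PQ; rewrite lt_def edist_ge0 andbT; apply: contra_neq PQ => d0.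
have := edist_sqr P Q; rewrite d0 expr0n /= => /esym/eqP.
rewrite paddr_eq0 ?sqr_ge0 // !sqrf_eq0 !subr_eq0 => /andP[/eqP e1 /eqP e2].
exact: point_eq.
Qed.

Lemma sqr_jensen (a b c u v w : K) : 0 <= a -> 0 <= b -> 0 <= c ->
  a + b + c = 1 ->
  (a * u + b * v + c * w) ^+ 2 <= a * u ^+ 2 + b * v ^+ 2 + c * w ^+ 2.
Proof.
move=> a0 b0 c0 e.
have -> : a * u ^+ 2 + b * v ^+ 2 + c * w ^+ 2 =
  (a * u + b * v + c * w) ^+ 2 +
  (a * b * (u - v) ^+ 2 + b * c * (v - w) ^+ 2 + a * c * (u - w) ^+ 2).
  have -> : a = 1 - b - c by lra.
  ring.
by rewrite lerDl !addr_ge0 // mulr_ge0 ?sqr_ge0 // mulr_ge0.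
Qed.

Lemma edist_tri_set A B C X Q r : 0 <= r -> tri_set A B C Q ->
  edist A X <= r -> edist B X <= r -> edist C X <= r -> edist Q X <= r.
Proof.
move=> r0 [a [b [c [a0 b0 c0 e ->]]]]; rewrite !edist_le //= => hA hB hC.
rewrite /GRing.scale /=.
have -> : a * A.1 + b * B.1 + c * C.1 - X.1 =
  a * (A.1 - X.1) + b * (B.1 - X.1) + c * (C.1 - X.1).
  by have -> : a = 1 - b - c by [lra]; ring.
have -> : a * A.2 + b * B.2 + c * C.2 - X.2 =
  a * (A.2 - X.2) + b * (B.2 - X.2) + c * (C.2 - X.2).
  by have -> : a = 1 - b - c by [lra]; ring.
apply: (le_trans (lerD (sqr_jensen _ _ _ a0 b0 c0 e) (sqr_jensen _ _ _ a0 b0 c0 e))).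
have -> : r ^+ 2 = a * r ^+ 2 + b * r ^+ 2 + c * r ^+ 2.
  by rewrite -!mulrDl e mul1r.
have := ler_wpM2l a0 hA; have := ler_wpM2l b0 hB; have := ler_wpM2l c0 hC.
lra.
Qed.

(** [X] enters with the positive weight [1 - l - m] and is at distance 0 from itself, so convexity
    of the squared distance gives a strict bound. *)
Lemma edist_shrink A B C X r (l m : K) : 0 < r -> 0 <= l -> 0 <= m ->
  l + m < 1 -> A = (1 - l - m) *: X + l *: B + m *: C ->
  edist X B <= r -> edist X C <= r -> edist X A < r.
Proof.
move=> r0 l0 m0 lm1 ->; rewrite edist_lt ?(ltW r0) // !edist_le ?(ltW r0) //=.
rewrite /GRing.scale /= => hB hC.
have -> : X.1 - ((1 - l - m) * X.1 + l * B.1 + m * C.1) =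
  (1 - l - m) * 0 + l * (X.1 - B.1) + m * (X.1 - C.1) by ring.
have -> : X.2 - ((1 - l - m) * X.2 + l * B.2 + m * C.2) =
  (1 - l - m) * 0 + l * (X.2 - B.2) + m * (X.2 - C.2) by ring.
have k0 : 0 <= 1 - l - m by lra.
have e1 : (1 - l - m) + l + m = 1 by ring.
apply: (le_lt_trans (lerD (sqr_jensen _ _ _ k0 l0 m0 e1) (sqr_jensen _ _ _ k0 l0 m0 e1))).
have r2 : 0 < r ^+ 2 by rewrite exprn_gt0.
have := ler_wpM2l l0 hB; have := ler_wpM2l m0 hC.
have : (l + m) * r ^+ 2 < 1 * r ^+ 2 by rewrite ltr_pM2r.
rewrite expr0n /=; lra.
Qed.

Lemma disc_orient P Q c rho : 0 <= rho ->
  (forall y, closed_disc c rho y -> 0 <= orient P Q y) ->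
  rho * edist P Q <= orient P Q c.
Proof.
move=> rho0 H; have [->|PQ] := eqVneq P Q.
  suff [-> ->] : edist Q Q = 0 /\ orient Q Q c = 0 by rewrite mulr0.
  split; last by rewrite /orient !subrr !mul0r subrr.
  by apply/eqP; rewrite -sqrf_eq0 edist_sqr !subrr expr0n addr0.
have d0 := edist_gt0 PQ; set d := edist P Q in d0 *.
have dE : d ^+ 2 = (P.1 - Q.1) ^+ 2 + (P.2 - Q.2) ^+ 2 by exact: edist_sqr.
have dn0 : d != 0 by rewrite gt_eqF.
(* The point of the disc furthest to the right of the line [PQ]: [c] shifted by [rho] along the unit
   normal, where [orient P Q] has dropped by [rho * d]. *)
have := H (c.1 + rho / d * (Q.2 - P.2), c.2 - rho / d * (Q.1 - P.1)).
rewrite /closed_disc /= edist_le //=.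
have -> : (c.1 - (c.1 + rho / d * (Q.2 - P.2))) ^+ 2 +
    (c.2 - (c.2 - rho / d * (Q.1 - P.1))) ^+ 2 = (rho / d) ^+ 2 * d ^+ 2.
  by rewrite dE; ring.
rewrite -exprMn divfK // lexx => /(_ isT).
rewrite {1}/orient /=.
have -> : (Q.1 - P.1) * (c.2 - rho / d * (Q.1 - P.1) - P.2) -
   (Q.2 - P.2) * (c.1 + rho / d * (Q.2 - P.2) - P.1) =
   orient P Q c - rho / d * d ^+ 2 by rewrite dE /orient; ring.
by rewrite expr2 mulrA divfK // subr_ge0.
Qed.

Lemma heron A B X : 4 * orient A B X ^+ 2 =
  (edist X A + edist X B + edist A B) * (edist X A + edist X B - edist A B) *
  (edist A B ^+ 2 - (edist X A - edist X B) ^+ 2).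
Proof.
set p := edist X A; set q := edist X B; set a := edist A B.
have -> : (p + q + a) * (p + q - a) * (a ^+ 2 - (p - q) ^+ 2) =
  4 * p ^+ 2 * q ^+ 2 - (p ^+ 2 + q ^+ 2 - a ^+ 2) ^+ 2 by ring.
by rewrite !edist_sqr /orient; ring.
Qed.

(** Adding [disc_orient] over the three sides bounds [rho] times the perimeter by twice the area.
    Squaring, inserting [heron] and cancelling the perimeter gives the bound, after the squared
    difference of the legs is dropped. *)
Lemma inscribed_disc X A B c rho : 0 < orient A B X -> 0 <= rho ->
  closed_disc c rho `<=` tri_set X A B ->
  [/\ 0 < edist A B & 4 * rho ^+ 2 * (edist X A + edist X B + edist A B) <=
      (edist X A + edist X B - edist A B) * edist A B ^+ 2].
Proof.
move=> o0 rho0 sub.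
have AB : A != B.
  by apply: contraTneq o0 => ->; rewrite /orient !subrr !mul0r subrr ltxx.
have a0 := edist_gt0 AB; split=> //.
have h1 : rho * edist A B <= orient A B c.
  by apply: disc_orient => // y /sub /(tri_set_orient _ o0)[].
have h2 : rho * edist B X <= orient B X c.
  by apply: disc_orient => // y /sub /(tri_set_orient _ o0)[].
have h3 : rho * edist X A <= orient X A c.
  by apply: disc_orient => // y /sub /(tri_set_orient _ o0)[].
have hs : rho * (edist X A + edist X B + edist A B) <= orient A B X.
  by rewrite -(orient_sum A B X c) (edistC X B) !mulrDr; lra.
have := heron A B X; move: (edist_ge0 X A) (edist_ge0 X B) a0 hs.
move: (edist X A) (edist X B) (edist A B) (orient A B X) o0 => p q a o o0 p0 q0 a0.
set s := p + q + a => hs he.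
have s0 : 0 < s by rewrite /s; lra.
have hs2 : (rho * s) ^+ 2 <= o ^+ 2.
  by rewrite ler_pXn2r // nnegrE ?mulr_ge0 // ltW.
have {}hs2 : 4 * rho ^+ 2 * s <= (p + q - a) * (a ^+ 2 - (p - q) ^+ 2).
  rewrite -(ler_pM2l s0) [leRHS]mulrA -he.
  have -> : s * (4 * rho ^+ 2 * s) = 4 * (rho * s) ^+ 2 by ring.
  by rewrite ler_pM2l.
(* The triangle inequality, read off from the positive area in Heron's formula; it is the sign
   needed to drop [(p - q) ^+ 2]. *)
have tri : 0 <= p + q - a.
  rewrite leNgt; apply/negP => lt0.
  have : 4 * o ^+ 2 <= 0.
    rewrite he -mulrA mulr_ge0_le0 ?(ltW s0) // mulr_le0_ge0 ?(ltW lt0) //.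
    have -> : a ^+ 2 - (p - q) ^+ 2 = (a - p + q) * (a + p - q) by ring.
    by rewrite mulr_ge0 //; lra.
  by apply/negP; rewrite -ltNge mulr_gt0 // exprn_gt0.
apply: (le_trans hs2); rewrite ler_wpM2l // gerBl.
exact: sqr_ge0.
Qed.

(* With [x] half the base and [m] the mean of the legs, the inscribed disc gives
   [rho^2 (m + x) <= (m - x) x^2]; replacing [m] by [r > m] makes it strict. *)
Lemma no_large_inscribed_disc X A B c rho r R :
  orient A B X != 0 -> 0 < rho ->
  (forall x, 0 < x -> x <= R / 2 ->
     0 <= x ^+ 3 - r * x ^+ 2 + rho ^+ 2 * x + rho ^+ 2 * r) ->
  edist X A + edist X B < 2 * r -> edist A B <= R ->
  ~ closed_disc c rho `<=` tri_set X A B.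
Proof.
wlog o0 : A B / 0 < orient A B X => [hw on0|_] rho0 hf hr hR sub.
  have [lt|gt] := ltP (orient A B X) 0; last first.
    have o0 : 0 < orient A B X by rewrite lt_def on0.
    exact: (hw A B o0 on0 rho0 hf hr hR sub).
  have o0 : 0 < orient B A X by rewrite orient_swap oppr_gt0.
  have hr' : edist X B + edist X A < 2 * r by rewrite addrC.
  have hR' : edist B A <= R by rewrite edistC.
  have n0 : orient B A X != 0 by rewrite gt_eqF.
  exact: (hw B A o0 n0 rho0 hf hr' hR' (subset_trans sub (@tri_setC _ X A B))).
have [a0] := inscribed_disc o0 (ltW rho0) sub.
move: (edist_ge0 X A) (edist_ge0 X B) hr hR a0.
move: (edist X A) (edist X B) (edist A B) => p q a p0 q0 hr hR a0 h.
have := hf (a / 2) ltac:(lra) ltac:(lra).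
pose x := a / 2; pose m := (p + q) / 2.
have x0 : 0 < x by rewrite /x; lra.
have m0 : 0 <= m by rewrite /m; lra.
have mr : m < r by rewrite /m; lra.
rewrite -/x.
have {}h : rho ^+ 2 * (m + x) <= (m - x) * x ^+ 2.
  have e1 : 4 * rho ^+ 2 * (p + q + a) = 8 * (rho ^+ 2 * (m + x)).
    by rewrite /m /x; field.
  have e2 : (p + q - a) * a ^+ 2 = 8 * ((m - x) * x ^+ 2).
    by rewrite /m /x; field.
  by move: h; rewrite e1 e2 ler_pM2l.
(* This follows from [m - x < m + x]; it makes the cubic strictly decreasing in its parameter, which
   passes from [m] to [r]. *)
have lt : rho ^+ 2 < x ^+ 2.
  rewrite -(@ltr_pM2r _ (m + x)); last lra.
  apply: (le_lt_trans h); rewrite mulrC ltr_pM2l ?exprn_gt0 //; lra.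
apply/negP; rewrite -ltNge.
have -> : x ^+ 3 - r * x ^+ 2 + rho ^+ 2 * x + rho ^+ 2 * r =
  (rho ^+ 2 * (m + x) - (m - x) * x ^+ 2) - (r - m) * (x ^+ 2 - rho ^+ 2) by ring.
have : 0 < (r - m) * (x ^+ 2 - rho ^+ 2) by rewrite mulr_gt0 // subr_gt0.
lra.
Qed.

Lemma bound_polyE r d x :
  (bound_poly r d).[x] = x ^+ 3 - r * x ^+ 2 + d ^+ 2 * x + d ^+ 2 * r.
Proof. by rewrite /bound_poly !hornerE. Qed.

(** For [d] up to the threshold the cubic is positive at 0, so a negative value at
    [x <= R / 2 <= xs] would force a root before the smallest positive one. Beyond the threshold
    [x <= r / 2] suffices, the cubic being increasing in [d ^+ 2]. *)
Lemma admissible_bound r b (delta : 'I_b -> K) R d x : 0 < r ->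
  admissible r delta R -> is_min delta d -> 0 < d -> 0 < x -> x <= R / 2 ->
  0 <= x ^+ 3 - r * x ^+ 2 + d ^+ 2 * x + d ^+ 2 * r.
Proof.
move=> r0 [R0 Rr hmin] dmin d0 x0 xR.
have [dle|dgt] := leP d (Num.sqrt 3 / 6 * r).
  have [xs [xs0 _ xsmin] Rxs] := hmin _ dmin dle.
  rewrite -bound_polyE leNgt; apply/negP => fneg.
  have f0 : 0 <= (- bound_poly r d).[x] by rewrite hornerN oppr_ge0 ltW.
  have f00 : (- bound_poly r d).[0] <= 0.
    rewrite hornerN bound_polyE !expr0n /= !mulr0 subrr !add0r oppr_le0.
    by rewrite mulr_ge0 ?sqr_ge0 // ltW.
  have [] := @poly_ivt _ (- bound_poly r d) 0 x (ltW x0); first by rewrite f00.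
  move=> y /andP[y0 yx]; rewrite rootN => ry.
  have y_neq0 : y != 0.
    apply: contraTneq ry => ->; rewrite /root bound_polyE !expr0n /= !mulr0.
    by rewrite subrr !add0r mulf_neq0 ?sqrf_eq0 ?gt_eqF.
  have y_gt0 : 0 < y by rewrite lt_def y_neq0.
  have := xsmin y y_gt0 ry => xsy.
  have xy : y = x by apply/eqP; rewrite eq_le yx /=; lra.
  by move: fneg ry; rewrite -xy /root => /ltr0_neq0 /negPf ->.
have d2 : 3 / 36 * r ^+ 2 <= d ^+ 2.
  have -> : 3 / 36 * r ^+ 2 = (Num.sqrt 3 / 6 * r) ^+ 2.
    by rewrite !exprMn exprVn sqr_sqrtr; [field | lra].
  by rewrite ler_pXn2r ?nnegrE ?(ltW d0) ?(ltW dgt) // mulr_ge0 ?(ltW r0) // divr_ge0 ?sqrtr_ge0.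
(* The second summand is the cubic at the threshold [d ^+ 2 = r ^+ 2 / 12], where [r / 2] is a
   root. *)
have -> : x ^+ 3 - r * x ^+ 2 + d ^+ 2 * x + d ^+ 2 * r =
  (d ^+ 2 - 3 / 36 * r ^+ 2) * (x + r) +
  (r / 2 - x) * (r ^+ 2 / 6 + x * (r / 2 - x)) by field.
apply: addr_ge0; apply: mulr_ge0; rewrite ?subr_ge0 //; try lra.
by rewrite addr_ge0 ?divr_ge0 ?sqr_ge0 // mulr_ge0; lra.
Qed.

End Metric.

(** * Components, closures and trapping in the plane *)

Section PlaneTopology.
Variable K : realType.
Implicit Types (P Q X Y A B C z w x y : K * K) (S U : set (K * K)) (e : K).

Lemma ball_coord x e y :
  ball x e y <-> `|x.1 - y.1| < e /\ `|x.2 - y.2| < e.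
Proof. by split=> [[]|[]]; rewrite /ball /=; split. Qed.

Lemma lin_continuous P Q : continuous (lin P Q).
Proof.
move=> t; apply: cvgD; apply: cvgZr_tmp.
  by apply: cvgB; [exact: cvg_cst | exact: cvg_id].
exact: cvg_id.
Qed.

Lemma segmentE P Q : segment P Q = lin P Q @` `[0, 1].
Proof. by apply/seteqP; split => _ [t t01 <-]; exists t => //; move: t01; rewrite /= in_itv. Qed.

Lemma segment_set_connected P Q : connected (segment P Q).
Proof.
rewrite segmentE; apply: connected_continuous_connected.
  exact: segment_connected.
exact/continuous_subspaceT/lin_continuous.
Qed.

Lemma segment_closed P Q : closed (segment P Q).
Proof.
rewrite segmentE; apply: compact_closed; first exact: norm_hausdorff.
apply: continuous_compact; last exact: segment_compact.
exact/continuous_subspaceT/lin_continuous.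
Qed.

Lemma fst_continuous : continuous (fun y : K * K => y.1).
Proof. by move=> y; exact: cvg_fst. Qed.

Lemma snd_continuous : continuous (fun y : K * K => y.2).
Proof. by move=> y; exact: cvg_snd. Qed.

Lemma orient_continuous P Q : continuous (orient P Q).
Proof.
move=> y; rewrite /orient; apply: cvgB; apply: cvgM; try exact: cvg_cst.
- by apply: cvgB; [exact: snd_continuous | exact: cvg_cst].
- by apply: cvgB; [exact: fst_continuous | exact: cvg_cst].
Qed.

Lemma orient_ge0_closed P Q : closed [set y | 0 <= orient P Q y].
Proof.
by apply: (@preimage_closed _ _ (orient P Q) [set t | 0 <= t]);
  [move=> y _; exact: orient_continuous | exact: closed_ge].
Qed.

Lemma orient_gt0_open P Q : open [set y | 0 < orient P Q y].
Proof.
by apply: (@open_comp _ _ (orient P Q) [set t | 0 < t]);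
  [move=> y _; exact: orient_continuous | exact: open_gt].
Qed.

Lemma component_segment S x y : segment x y `<=` S -> connected_component S x y.
Proof.
move=> xyS; exists (segment x y); last exact: segment_r.
by split=> //; [exact: segment_l | exact: segment_set_connected].
Qed.

Lemma ball_seg_convex x e : seg_convex (ball x e).
Proof.
move=> y y' /ball_coord[y1 y2] /ball_coord[y1' y2'] _ [t /andP[t0 t1] <-].
suff key (a b c : K) : `|a - b| < e -> `|a - c| < e ->
    `|a - ((1 - t) * b + t * c)| < e.
  by apply/ball_coord; split; apply: key.
move=> hb hc.
have -> : a - ((1 - t) * b + t * c) = (1 - t) * (a - b) + t * (a - c) by ring.
apply: (le_lt_trans (ler_normD _ _)); rewrite !normrM.
rewrite (ger0_norm t0) (@ger0_norm _ (1 - t)); last lra.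
have [->|tn0] := eqVneq t 0; first by rewrite subr0 mul1r mul0r addr0.
have t_gt0 : 0 < t by rewrite lt_def tn0.
have -> : e = (1 - t) * e + t * e by ring.
by apply: ler_ltD; [rewrite ler_wpM2l ?(ltW hb) //; lra | rewrite ltr_pM2l].
Qed.

(** The plane is locally connected, since balls are convex. *)
Lemma component_open S x : open S -> open (connected_component S x).
Proof.
move=> Sopen; rewrite openE => y xy.
have Sy : S y by exact: connected_component_sub xy.
have /nbhs_ballP[e /= e0 ballS] := open_nbhs_nbhs (conj Sopen Sy).
apply/nbhs_ballP; exists e => //= y' yy'.
apply: (connected_component_trans xy); apply: component_segment.
apply: subset_trans ballS; apply: ball_seg_convex => //; exact: ballxx.
Qed.

Lemma lin_near w y V : nbhs w V -> exists t, [/\ 0 < t, t <= 1 & V (lin w y t)].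
Proof.
move=> Vw; have /(@lin_continuous w y 0 V) : nbhs (lin w y 0) V by rewrite lin0.
move=> /nbhs_ballP[e /= e0 eV].
pose t := Num.min (e / 2) 1.
have t0 : 0 < t by rewrite lt_min ltr01 divr_gt0.
have t1 : t <= 1 by rewrite ge_min lexx orbT.
have te : t < e by rewrite gt_min ltr_pdivrMr // ltr_pMr // ltr1n.
by exists t; split=> //; apply: eV; rewrite /ball /= sub0r normrN gtr0_norm.
Qed.

(** The points [lin w y t] with small [t] approach [w] and are joined to [y] inside [S]. The point
    [w] itself may lie outside [S], as when [S] is the complement of a curve through [w]. *)
Lemma closure_component S y w :
  (forall t, 0 < t -> t <= 1 -> S (lin w y t)) ->
  closure (connected_component S y) w.
Proof.
move=> H V /(lin_near y)[t [t0 t1 Vt]]; exists (lin w y t); split=> //.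
apply: component_segment => _ [s /andP[s0 s1] <-].
have -> : lin y (lin w y t) s = lin w y (1 - s + s * t).
  by apply: point_eq; rewrite /= /GRing.scale /=; ring.
have st : 0 <= s * t by rewrite mulr_ge0 // ltW.
have st1 : s * t <= s by rewrite ler_piMr.
apply: H; last lra.
by have [->|sn1] := eqVneq s 1; [rewrite subrr add0r mul1r | lra].
Qed.

Lemma tri_set_side X A B y : 0 < orient A B X -> tri_set X A B y ->
  orient A B y = 0 -> segment A B y.
Proof.
move=> o0 [t [a [b [t0 a0 b0 e ->]]]]; rewrite orient_comb //.
have -> : orient A B A = 0 by rewrite /orient; ring.
have -> : orient A B B = 0 by rewrite /orient; ring.
rewrite !mulr0 !addr0 => /eqP; rewrite mulf_eq0 (gt_eqF o0) orbF => /eqP t00.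
exists b; first by apply/andP; split=> //; lra.
have -> : a = 1 - b by lra.
by rewrite t00 scale0r add0r.
Qed.

Lemma tri_set_closed X A B : 0 < orient A B X -> closed (tri_set X A B).
Proof.
move=> o0; have -> : tri_set X A B = [set y | 0 <= orient A B y] `&`
    ([set y | 0 <= orient B X y] `&` [set y | 0 <= orient X A y]).
  apply/seteqP; split=> y; first by move=> /(tri_set_orient y o0)[].
  by move=> [h1 [h2 h3]]; apply/tri_set_orient.
by do !apply: closedI; exact: orient_ge0_closed.
Qed.

Definition perimeter X A B : set (K * K) :=
  segment X A `|` segment X B `|` segment A B.

Lemma tri_set_interior X A B y : 0 < orient A B X ->
  tri_set X A B y -> ~ perimeter X A B y ->
  [/\ 0 < orient A B y, 0 < orient B X y & 0 < orient X A y].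
Proof.
move=> o0 Dy np.
have o2 : 0 < orient B X A by rewrite -orient_rot.
have o3 : 0 < orient X A B by rewrite -orient_rot.
have [h1 h2 h3] := (tri_set_orient y o0).1 Dy.
split; rewrite lt_def ?h1 ?h2 ?h3 andbT; apply/eqP => e; apply: np.
- by right; exact: (tri_set_side o0).
- left; right; rewrite segmentC; apply: (tri_set_side o2) => //.
  by do 2 apply: tri_setR; do 2 apply: tri_setR; exact: Dy.
- by left; left; apply: (tri_set_side o3) => //; do 2 apply: tri_setR.
Qed.

(** The trace of the triangle on [U] is closed in [U]; since [U] avoids the perimeter, it is also
    the trace of the open triangle, hence open in [U]. *)
Lemma connected_trapped U X A B : 0 < orient A B X -> connected U ->
  U `&` tri_set X A B !=set0 -> U `&` perimeter X A B = set0 ->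
  U `<=` tri_set X A B.
Proof.
move=> o0 cU UD0 UP0.
suff <- : U `&` tri_set X A B = U by move=> y [].
apply: cU => //; last by exists (tri_set X A B) => //; exact: tri_set_closed.
exists ([set y | 0 < orient A B y] `&`
    ([set y | 0 < orient B X y] `&` [set y | 0 < orient X A y])).
  by do !apply: openI; exact: orient_gt0_open.
apply/seteqP; split=> y [Uy /=].
  move=> Dy; split=> //; have np : ~ perimeter X A B y.
    by move=> Py; have : (U `&` perimeter X A B) y by []; rewrite UP0.
  by have [] := tri_set_interior o0 Dy np.
by move=> [h1 [h2 h3]]; split=> //; apply/tri_set_orient => //; split; exact: ltW.
Qed.

Lemma bounded_set_le S M : (forall y, S y -> `|y| <= M) -> bounded_set S.
Proof.
move=> H; exists M; split; first exact: num_real.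
by move=> N MN y Sy; exact: le_trans (H y Sy) (ltW MN).
Qed.

Lemma bounded_set_ex S : bounded_set S -> exists M, forall y, S y -> `|y| <= M.
Proof. by move=> [M [_ /(_ (M + 1))H]]; exists (M + 1) => y; apply: H; lra. Qed.

Lemma tri_set_bounded X A B : bounded_set (tri_set X A B).
Proof.
apply: (@bounded_set_le _ (`|X| + `|A| + `|B|)).
move=> _ [t [a [b [t0 a0 b0 e ->]]]].
have key (s : K) Y : 0 <= s -> s <= 1 -> `|s *: Y| <= `|Y|.
  by move=> s0 s1; rewrite prod_norm_scale ger0_norm // ler_piMl.
apply: (le_trans (ler_normD _ _)); apply: lerD; last by apply: key => //; lra.
by apply: (le_trans (ler_normD _ _)); apply: lerD; apply: key => //; lra.
Qed.

(** The ray from [z] along the normal [n] moves away from the line [PQ], so it stays in the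
    half-plane and therefore in the component of [z]. *)
Lemma half_plane_unbounded S P Q z : orient P Q z < 0 ->
  [set y | orient P Q y < 0] `<=` S ->
  ~ bounded_set (connected_component S z).
Proof.
move=> oz HS /bounded_set_ex[M HM].
pose n : K * K := (Q.2 - P.2, P.1 - Q.1).
have on t : 0 <= t -> orient P Q (z + t *: n) < 0.
  move=> t0; have -> : orient P Q (z + t *: n) = orient P Q z -
      t * ((Q.1 - P.1) ^+ 2 + (Q.2 - P.2) ^+ 2).
    by rewrite /orient /= /GRing.scale /=; ring.
  rewrite subr_lt0; apply: (lt_le_trans oz).
  by rewrite mulr_ge0 // addr_ge0 // sqr_ge0.
have bound t : 0 <= t -> `|t *: n| <= M + `|z|.
  move=> t0; have : `|z + t *: n| <= M.
    apply/HM/component_segment => _ [s /andP[s0 s1] <-]; apply: HS => /=.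
    have -> : lin z (z + t *: n) s = z + (s * t) *: n.
      by apply: point_eq; rewrite /= /GRing.scale /=; ring.
    by apply: on; rewrite mulr_ge0.
  move=> h; have -> : t *: n = (z + t *: n) - z by rewrite addrC addKr.
  by apply: (le_trans (ler_normB _ _)); rewrite lerD2r.
have n0 : 0 < `|n|.
  rewrite normr_gt0; apply: contraTneq oz => -[e1 e2].
  by rewrite /orient e1; have -> : Q.1 - P.1 = 0 by [lra]; rewrite !mul0r subrr ltxx.
have Mz : 0 <= M + `|z| by rewrite (le_trans _ (bound 0 (lexx _))).
have := bound ((M + `|z| + 1) / `|n|) ltac:(by rewrite divr_ge0 ?ltW //; lra).
rewrite prod_norm_scale ger0_norm; last by rewrite divr_ge0 ?ltW //; lra.
by rewrite divfK ?gt_eqF //; lra.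
Qed.

End PlaneTopology.

(** * The complement of two rays near their common origin *)

Section SimplePolygons.
Variable K : realType.
Implicit Types (P Q X Y A B C z w x y a b : K * K) (S U : set (K * K)) (e : K).
Implicit Types s : seq (K * K).

Lemma collinear z a y : a != z -> orient z a y = 0 ->
  exists rho, y = z + rho *: (a - z).
Proof.
move=> az; rewrite /orient => o0.
have [e1|n1] := eqVneq (a.1 - z.1) 0.
  have n2 : a.2 - z.2 != 0.
    by apply: contraNneq az => e2; apply/eqP/point_eq; lra.
  exists ((y.2 - z.2) / (a.2 - z.2)); apply: point_eq; rewrite /= /GRing.scale /=.
    rewrite e1 mulr0 addr0; move: o0; rewrite e1 mul0r sub0r => /eqP.
    by rewrite oppr_eq0 mulf_eq0 (negPf n2) /= subr_eq0 => /eqP.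
  by rewrite divfK // addrC subrK.
exists ((y.1 - z.1) / (a.1 - z.1)); apply: point_eq; rewrite /= /GRing.scale /=.
  by rewrite divfK // addrC subrK.
apply: (mulfI n1); rewrite mulrDr mulrA [_ * (_ / _)]mulrC divfK //.
by move: o0; lra.
Qed.

(** Two rays with distinct directions cut the ball into two pieces. Each piece lies in a single
    component of the complement of [S], and every point of the rays is accessible from it along a
    segment. *)
Lemma two_rays_closure S z a b e : a != z -> b != z -> 0 < e ->
  (forall c, 0 < c -> b - z <> c *: (a - z)) ->
  (forall y, ball z e y -> S y -> exists2 rho, 0 <= rho &
     y = z + rho *: (a - z) \/ y = z + rho *: (b - z)) ->
  (forall rho y, 0 <= rho -> y = z + rho *: (a - z) \/ y = z + rho *: (b - z) ->
     ball z e y -> S y) ->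
  forall y w, ball z e y -> ~ S y -> ball z e w -> S w ->
    closure (connected_component (~` S) y) w.
Proof.
wlog o0 : a b / 0 <= orient z a b.
  move=> hw az bz e0 nsame H1 H2.
  have [p0|p0] := leP 0 (orient z a b); first exact: (hw a b).
  apply: (hw b a) => //.
  - have -> : orient z b a = - orient z a b by rewrite /orient; ring.
    by rewrite oppr_ge0 ltW.
  - move=> c c0 ab; apply: (nsame c^-1); first by rewrite invr_gt0.
    by rewrite ab scalerA mulVf ?scale1r // gt_eqF.
  - by move=> y zy /(H1 y zy)[rho rho0 [|] ->]; exists rho => //; [right|left].
  - by move=> rho y rho0 h; apply: (H2 rho) => //; case: h; [right|left].
move=> az bz e0 nsame H1 H2 y w zy nSy zw Sw.
have zz : ball z e z by exact: ballxx.
have linball u v t : ball z e u -> ball z e v -> 0 <= t <= 1 ->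
    ball z e (lin u v t).
  by move=> zu zv t01; apply: (ball_seg_convex zu zv); exists t.
have ra rho : orient z a (z + rho *: (a - z)) = 0.
  by rewrite /orient /= /GRing.scale /=; ring.
(* Opposite rays form a line, and a segment from a point of the line to [y] off it leaves the line
   at once. *)
have [p00|on0] := eqVneq (orient z a b) 0.
  have [l bE] := collinear az p00.
  have bzE : b - z = l *: (a - z) by rewrite {1}bE addrC addKr.
  have l0 : l < 0.
    rewrite ltNge le_eqVlt; apply/negP => /predU1P[l0|l0].
      by move: bz; rewrite bE -l0 scale0r addr0 eqxx.
    exact: (nsame l l0).
  have S0 u : ball z e u -> S u -> orient z a u = 0.
    move=> zu /(H1 u zu)[rho _ [->|->]]; first exact: ra.
    by rewrite bzE scalerA ra.
  have yn0 : orient z a y != 0.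
    apply/eqP => oy; apply: nSy; have [rho yE] := collinear az oy.
    have [rho0|rho0] := leP 0 rho; first by apply: (H2 rho) => //; left.
    apply: (H2 (rho / l)) => //.
      by rewrite -mulrNN -invrN divr_ge0 // oppr_ge0 ltW.
    by right; rewrite bzE scalerA divfK // lt_eqF.
  apply: closure_component => t t0 t1 Sl.
  have := S0 _ (linball w y t zw zy ltac:(by rewrite ltW)) Sl.
  rewrite orient_lin (S0 w) // mulr0 add0r => /eqP.
  by rewrite mulf_eq0 (gt_eqF t0) (negPf yn0).
have {on0}o0 : 0 < orient z a b by rewrite lt_def on0.
(* [orient b z] and [orient z a] are, up to the factor [orient z a b], the
   coordinates in the frame [(a - z, b - z)] at [z]. *)
have rayE u rho : u = z + rho *: (a - z) \/ u = z + rho *: (b - z) ->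
    (orient b z u = rho * orient z a b /\ orient z a u = 0) \/
    (orient b z u = 0 /\ orient z a u = rho * orient z a b).
  by case=> ->; [left|right]; split; rewrite /orient /= /GRing.scale /=; ring.
have Sray u : ball z e u -> S u ->
    (0 <= orient b z u /\ orient z a u = 0) \/
    (orient b z u = 0 /\ 0 <= orient z a u).
  move=> zu /(H1 u zu)[rho rho0 /rayE[[-> ->]|[-> ->]]]; [left|right];
  by split=> //; rewrite mulr_ge0 // ltW.
have neg1 u : ball z e u -> orient b z u < 0 -> ~ S u.
  by move=> zu u0 /(Sray u zu)[[]|[]]; lra.
have neg2 u : ball z e u -> orient z a u < 0 -> ~ S u.
  by move=> zu u0 /(Sray u zu)[[]|[]]; lra.
have pos u : ball z e u -> 0 < orient b z u -> 0 < orient z a u -> ~ S u.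
  by move=> zu u0 u1 /(Sray u zu)[[]|[]]; lra.
have Sw' := Sray w zw Sw.
(* The reflex piece is the union of the half-discs [neg1] and [neg2]. Their common point [m] is
   taken in the direction opposite to the sum of the two rays: [3 *: z - a - b] is
   [z - (a - z) - (b - z)]. *)
have [m [zm m1 m2]] : exists m, [/\ ball z e m, orient b z m < 0 & orient z a m < 0].
  have /lin_near-/(_ (3 *: z - a - b))[t [t0 t1 zt]] : nbhs z (ball z e).
    exact: nbhsx_ballx.
  exists (lin z (3 *: z - a - b) t); split=> //.
    have -> : orient b z (lin z (3 *: z - a - b) t) = - (t * orient z a b).
      by rewrite /orient /= /GRing.scale /=; ring.
    by rewrite oppr_lt0 mulr_gt0.
  have -> : orient z a (lin z (3 *: z - a - b) t) = - (t * orient z a b).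
    by rewrite /orient /= /GRing.scale /=; ring.
  by rewrite oppr_lt0 mulr_gt0.
have mw : closure (connected_component (~` S) m) w.
  apply: closure_component => t t0 t1.
  have zt : ball z e (lin w m t) by apply: linball => //; rewrite ltW.
  case: Sw' => [[_ w0]|[w0 _]]; [apply: neg2 => //|apply: neg1 => //].
    by rewrite orient_lin w0 mulr0 add0r pmulr_rlt0.
  by rewrite orient_lin w0 mulr0 add0r pmulr_rlt0.
have conv_neg (p q t : K) : p < 0 -> q < 0 -> 0 <= t <= 1 -> (1 - t) * p + t * q < 0.
  move=> p0 q0 /andP[t0 t1]; have [->|tn0] := eqVneq t 0.
    by rewrite subr0 mul1r mul0r addr0.
  have : t * q < 0 by rewrite pmulr_rlt0 // lt_def tn0.
  have : (1 - t) * p <= 0 by rewrite mulr_ge0_le0 ?(ltW p0) //; lra.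
  lra.
(* A point [y] of the reflex piece shares a half-disc with [m], hence lies in the component of
   [m]. *)
have [y1|y1] := ltP (orient b z y) 0.
  suff -> : connected_component (~` S) y = connected_component (~` S) m by [].
  apply/same_connected_component/component_segment => _ [t t01 <-].
  by apply: neg1; [exact: linball | rewrite orient_lin; exact: conv_neg].
have [y2|y2] := ltP (orient z a y) 0.
  suff -> : connected_component (~` S) y = connected_component (~` S) m by [].
  apply/same_connected_component/component_segment => _ [t t01 <-].
  by apply: neg2; [exact: linball | rewrite orient_lin; exact: conv_neg].
(* What remains is [y] in the closed sector between the rays. A vanishing coordinate would put [y]
   on a ray, so [y] is interior to the sector, which is convex. *)
have yE : y = z + (orient b z y / orient z a b) *: (a - z) +
    (orient z a y / orient z a b) *: (b - z).
  move: o0; rewrite /orient; case: (a) (b) (z) (y) => [a1 a2] [b1 b2] [z1 z2] [y1' y2'].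
  move=> /= /lt0r_neq0 o0; by apply: point_eq; rewrite /= /GRing.scale /=; field.
have y1' : orient b z y != 0.
  apply/eqP => e1; apply: nSy; apply: (H2 (orient z a y / orient z a b)) => //.
    by rewrite divr_ge0 // ltW.
  by right; rewrite {1}yE e1 mul0r scale0r addr0.
have y2' : orient z a y != 0.
  apply/eqP => e1; apply: nSy; apply: (H2 (orient b z y / orient z a b)) => //.
    by rewrite divr_ge0 // ltW.
  by left; rewrite {1}yE e1 mul0r scale0r addr0.
apply: closure_component => t t0 t1.
have zt : ball z e (lin w y t) by apply: linball => //; rewrite ltW.
have y1p : 0 < t * orient b z y by rewrite mulr_gt0 // lt_def y1'.
have y2p : 0 < t * orient z a y by rewrite mulr_gt0 // lt_def y2'.
by apply: pos => //; rewrite orient_lin ltr_wpDl // mulr_ge0 //; lra.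
Qed.

End SimplePolygons.

(** * Boundary curves of simple polygons *)

Section PolygonBoundary.
Variable K : realType.
Implicit Types (P Q X Y A B C z w x y a b : K * K) (S U : set (K * K)) (e : K).
Variable s : seq (K * K).
Hypothesis simple_s : simple_polygon s.
Local Notation n := (size s).

Let n3 : (3 <= n)%N. Proof. by case: simple_s. Qed.

Lemma next_index_lt i : (i < n)%N -> (i.+1 %% n < n)%N.
Proof. by move=> _; rewrite ltn_mod; lia. Qed.

Lemma next_indexE i : (i < n)%N ->
  (i.+1 %% n = if i.+1 == n then 0 else i.+1)%N.
Proof.
move=> li; case: eqP => [->|ne]; first by rewrite modnn.
by rewrite modn_small //; lia.
Qed.

Lemma prev_index i : (i < n)%N -> exists2 j, (j < n)%N & (j.+1 %% n = i)%N.
Proof.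
move=> li; pose j := (if i == 0 then n.-1 else i.-1)%N.
have lj : (j < n)%N by rewrite /j; case: eqP; lia.
exists j => //; rewrite next_indexE // /j; case: (i =P 0)%N => i0.
  by rewrite prednK ?eqxx //; lia.
by rewrite prednK ?ifN //; lia.
Qed.

Lemma half_open_inj i j z : (i < n)%N -> (j < n)%N ->
  half_open_segment s`_i (next_vertex s i) z ->
  half_open_segment s`_j (next_vertex s j) z -> i = j.
Proof.
case: simple_s => _ H.
wlog ij : i j / (i <= j)%N.
  move=> hw li lj hi hj; have [ij|ji] := leqP i j; first exact: hw.
  by apply/esym/(hw j i) => //; exact: ltnW.
move=> li lj hi hj; apply/eqP; rewrite eqn_leq ij /= leqNgt; apply/negP => ij'.
by have := H i j ltac:(by rewrite ij' lj); rewrite -subset0 => /(_ z); apply.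
Qed.

Lemma half_open_l P Q : half_open_segment P Q P.
Proof. by exists 0; [rewrite /= lexx ltr01 | exact: lin0]. Qed.

Lemma segment_half_open P Q z : segment P Q z -> half_open_segment P Q z \/ z = Q.
Proof.
move=> [t /andP[t0 t1] <-]; have [->|tn1] := eqVneq t 1; first by right; exact: lin1.
by left; exists t => //; apply/andP; split=> //; rewrite lt_neqAle tn1.
Qed.

Lemma next_vertex_neq i : (i < n)%N -> next_vertex s i != s`_i.
Proof.
move=> li; apply/eqP => e.
have := half_open_inj li (next_index_lt li) (half_open_l _ _).
rewrite -/(next_vertex s i) e => /(_ (half_open_l _ _)).
by rewrite (next_indexE li); case: eqP; lia.
Qed.

Lemma no_backtrack i j c : (i < n)%N -> (j < n)%N -> next_vertex s j = s`_i ->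
  0 < c -> s`_j - s`_i <> c *: (next_vertex s i - s`_i).
Proof.
move=> li lj ji c0 E.
have c1 : 0 < 1 + c by lra.
have cn : 1 + c != 0 by rewrite gt_eqF.
have ij : i = j.
  apply: (@half_open_inj i j (lin s`_i (next_vertex s i) (c / (1 + c)))) => //.
    exists (c / (1 + c)) => //; apply/andP; split; first by rewrite divr_ge0 // ltW.
    by rewrite ltr_pdivrMr // mul1r; lra.
  exists (c / (1 + c)).
    apply/andP; split; first by rewrite divr_ge0 // ltW.
    by rewrite ltr_pdivrMr // mul1r; lra.
  rewrite ji; have -> : s`_j = s`_i + c *: (next_vertex s i - s`_i).
    by rewrite -E addrC subrK.
  by apply: point_eq; rewrite /= /GRing.scale /=; field.
by have := next_vertex_neq li; rewrite {1}ij ji eqxx.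
Qed.

Lemma boundary_half_open z : boundary s z ->
  exists2 i, (i < n)%N & half_open_segment s`_i (next_vertex s i) z.
Proof.
move=> [i /= li /segment_half_open[h|->]]; first by exists i.
by exists (i.+1 %% n)%N; [exact: next_index_lt | exact: half_open_l].
Qed.

(** The edges missing [z] are finitely many closed sets, so their union misses a neighbourhood of
    [z]. *)
Lemma boundary_near z : \forall y \near z, boundary s y ->
  exists i, [/\ (i < n)%N, segment s`_i (next_vertex s i) z &
                segment s`_i (next_vertex s i) y].
Proof.
pose F := \bigcup_(i in [set i | (i < n)%N /\ ~ segment s`_i (next_vertex s i) z])
  segment s`_i (next_vertex s i).
have Fc : closed F.
  apply: closed_bigcup; last by move=> i _; exact: segment_closed.
  by apply: (@sub_finite_set _ _ `I_n); [move=> i [] | exact: finite_II].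
have : nbhs z (~` F).
  apply: open_nbhs_nbhs; split; first exact: closed_openC.
  by move=> [i [_]].
apply: filterS => y nFy [i /= li siy]; exists i; split=> //.
by apply: contrapT => h; apply: nFy; exists i.
Qed.

(** If all vertices were on one line, both neighbours of an extreme vertex would lie on the same
    side of it, contrary to [no_backtrack]. *)
Lemma not_collinear : exists2 j, (j < n)%N & orient s`_0 (next_vertex s 0) s`_j != 0.
Proof.
apply: contrapT => hn; have n0 : (0 < n)%N by lia.
set d := next_vertex s 0 - s`_0.
have dn : d != 0 by rewrite subr_eq0; exact: next_vertex_neq.
have /choice[tau tauE] : forall j : 'I_n, exists rho, s`_j = s`_0 + rho *: d.
  move=> j; apply: collinear; first exact: next_vertex_neq.
  by apply: contrapT => /eqP h; apply: hn; exists j.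
have [i _ imin] := arg_minP tau (erefl : xpredT (Ordinal n0)).
have step j : s`_j != s`_i -> (j < n)%N ->
    exists2 c, 0 < c & s`_j - s`_i = c *: d.
  move=> ji lj; have := tauE (Ordinal lj); rewrite /= => jE.
  have cE : s`_j - s`_i = (tau (Ordinal lj) - tau i) *: d.
    by rewrite jE tauE opprD addrACA subrr add0r scalerBl.
  exists (tau (Ordinal lj) - tau i) => //.
  rewrite lt_def subr_ge0 imin // andbT; apply: contraNneq ji => c0.
  by rewrite -subr_eq0 cE c0 scale0r.
have [j lj jE] := prev_index (ltn_ord i).
have ji : next_vertex s j = s`_i by rewrite /next_vertex jE.
have [c c0 cE] := step j ltac:(by rewrite -ji eq_sym next_vertex_neq) lj.
have [c' c'0 cE'] := step _ (next_vertex_neq (ltn_ord i)) (next_index_lt (ltn_ord i)).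
apply: (@no_backtrack i j (c / c')) => //; first by rewrite divr_gt0.
by rewrite [X in _ *: X]cE' cE scalerA divfK // gt_eqF.
Qed.

Lemma segment_ray P Q y : segment P Q y ->
  exists2 rho, 0 <= rho & y = P + rho *: (Q - P).
Proof.
move=> [t /andP[t0 t1] <-]; exists t => //.
by apply: point_eq; rewrite /= /GRing.scale /=; ring.
Qed.

Lemma ray_near_segment z a : a != z -> exists2 e, 0 < e &
  forall rho, 0 <= rho -> ball z e (z + rho *: (a - z)) ->
    segment z a (z + rho *: (a - z)).
Proof.
move=> az; have n0 : 0 < `|a - z| by rewrite normr_gt0 subr_eq0.
exists `|a - z| => // rho rho0; rewrite -ball_normE /= opprD addrA subrr sub0r.
rewrite normrN prod_norm_scale ger0_norm // gtr_pMl // => rho1.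
exists rho; first by rewrite /= rho0 ltW.
by apply: point_eq; rewrite /= /GRing.scale /=; ring.
Qed.

(** Near [z] the boundary is two rays with distinct directions, so [two_rays_closure] applies. *)
Lemma boundary_local z : boundary s z -> exists2 e, 0 < e &
  forall y w, ball z e y -> ~ boundary s y -> ball z e w -> boundary s w ->
    closure (connected_component (~` boundary s) y) w.
Proof.
move=> /boundary_half_open[i li hi].
suff [a [b [[az bz] nsame sa sb H1]]] : exists a b, [/\ a != z /\ b != z,
    forall c, 0 < c -> b - z <> c *: (a - z),
    segment z a `<=` boundary s, segment z b `<=` boundary s &
    forall j, (j < n)%N -> segment s`_j (next_vertex s j) z ->
      segment s`_j (next_vertex s j) `<=`
      [set y | (exists2 rho, 0 <= rho & y = z + rho *: (a - z) \/ y = z + rho *: (b - z))]].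
  have /nbhs_ballP[e /= e0 he] := boundary_near z.
  have [ea ea0 ha] := ray_near_segment az.
  have [eb eb0 hb] := ray_near_segment bz.
  (* Within [e] only the edges through [z] occur; within [ea] and [eb] the rays have not yet run
     past the points [a] and [b]. *)
  exists (Num.min e (Num.min ea eb)); first by rewrite !lt_min e0 ea0.
  have sub1 : ball z (Num.min e (Num.min ea eb)) `<=` ball z e.
    by apply: le_ball; rewrite ge_min lexx.
  have sub2 : ball z (Num.min e (Num.min ea eb)) `<=` ball z ea.
    by apply: le_ball; rewrite !ge_min lexx orbT.
  have sub3 : ball z (Num.min e (Num.min ea eb)) `<=` ball z eb.
    by apply: le_ball; rewrite !ge_min lexx !orbT.
  apply: (two_rays_closure az bz) => //; first by rewrite !lt_min e0 ea0.
    by move=> y /sub1/he hy /hy[j [lj zj yj]]; exact: (H1 j).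
  move=> rho y rho0 [->|->] zy.
    by apply/sa/ha => //; exact: sub2.
  by apply/sb/hb => //; exact: sub3.
have sub_edge j : (j < n)%N -> segment s`_j (next_vertex s j) `<=` boundary s.
  by move=> lj y hy; exists j.
have edges j : (j < n)%N -> segment s`_j (next_vertex s j) z ->
    j = i \/ (next_vertex s j = z /\ i = (j.+1 %% n)%N).
  move=> lj /segment_half_open[hj|zE]; first by left; exact: (half_open_inj lj li hj).
  right; split=> //; apply: (@half_open_inj _ _ z) => //; first exact: next_index_lt.
  by rewrite zE; exact: half_open_l.
have nxi := next_vertex_neq li.
(* At a vertex the rays follow the leaving and the arriving edge; inside an edge they point to its
   two ends. *)
have [zi|zi] := eqVneq z s`_i.
  have [j lj jE] := prev_index li.
  have jz : next_vertex s j = s`_i by rewrite /next_vertex jE.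
  exists (next_vertex s i), s`_j; split.
  - by rewrite zi; split=> //; rewrite -jz eq_sym; exact: next_vertex_neq.
  - by rewrite zi => c; exact: no_backtrack.
  - by rewrite zi; exact: sub_edge.
  - by rewrite zi -jz segmentC; exact: sub_edge.
  move=> k lk /(edges k lk)[->|[_ ik]] y.
    by rewrite -zi => /segment_ray[rho rho0 ->]; exists rho => //; left.
  have -> : k = j.
    move: jE; rewrite ik !next_indexE //.
    by case: (j.+1 =P n) => ?; case: (k.+1 =P n) => ?; lia.
  rewrite jz -zi segmentC => /segment_ray[rho rho0 ->].
  by exists rho => //; right.
have [t /andP[t0 t1] zE] := hi.
have t_gt0 : 0 < t.
  by rewrite lt_def t0 andbT; apply: contraNneq zi => t00; rewrite -zE t00 lin0.
have tn1 : 1 - t != 0 by rewrite subr_eq0 eq_sym lt_eqF.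
have aE : next_vertex s i - z = (1 - t) *: (next_vertex s i - s`_i).
  by rewrite -zE; apply: point_eq; rewrite /= /GRing.scale /=; ring.
have bE : s`_i - z = - t *: (next_vertex s i - s`_i).
  by rewrite -zE; apply: point_eq; rewrite /= /GRing.scale /=; ring.
have dn0 : next_vertex s i - s`_i != 0 by rewrite subr_eq0.
have zseg : segment s`_i (next_vertex s i) z by exists t => //; rewrite /= t0 ltW.
exists (next_vertex s i), s`_i; split.
- by split; [rewrite -subr_eq0 aE scaler_eq0 negb_or tn1 | rewrite eq_sym].
- move=> c c0; rewrite aE bE scalerA => /eqP; rewrite -subr_eq0 -scalerBl.
  rewrite scaler_eq0 (negPf dn0) orbF => /eqP h.
  have : 0 < c * (1 - t) by rewrite mulr_gt0 //; lra.
  lra.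
- apply: subset_trans (sub_edge _ li); apply: segment_seg_convex => //; exact: segment_r.
- apply: subset_trans (sub_edge _ li); apply: segment_seg_convex => //; exact: segment_l.
move=> k lk /(edges k lk)[->|[kz ik]] y.
  move=> [p _ <-]; have [pt|tp] := leP p t.
    exists ((t - p) / t); first by rewrite divr_ge0 //; lra.
    right; rewrite bE scalerA mulrN divfK ?gt_eqF // -zE.
    by apply: point_eq; rewrite /= /GRing.scale /=; ring.
  exists ((p - t) / (1 - t)); first by rewrite divr_ge0 //; lra.
  left; rewrite aE scalerA divfK // -zE.
  by apply: point_eq; rewrite /= /GRing.scale /=; ring.
by move: zi; rewrite -kz /next_vertex -ik eqxx.
Qed.

Lemma boundary_closed : closed (boundary s).
Proof.
apply: closed_bigcup; last by move=> i _; exact: segment_closed.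
exact: (finite_II n).
Qed.

Lemma boundary_connected : connected (boundary s).
Proof.
have key k : (k < n)%N ->
    connected (\bigcup_(i in `I_k.+1) segment s`_i (next_vertex s i)).
  elim: k => [|k IH] lk.
    by rewrite IIS II0 set0U bigcup_set1; exact: segment_set_connected.
  rewrite IIS bigcup_setU bigcup_set1.
  apply: connectedU; last exact: segment_set_connected.
    exists s`_k.+1; split; last exact: segment_l.
    exists k; first exact: ltnSn.
    by rewrite /next_vertex modn_small //; exact: segment_r.
  by apply: IH; lia.
have := key n.-1 ltac:(lia); rewrite prednK //; lia.
Qed.

(** The boundary is connected, and its trace on the closure of the component is closed, relatively
    open by [boundary_local], and nonempty. *)
Lemma boundary_sub_closure x : ~ boundary s x ->
  boundary s `<=` closure (connected_component (~` boundary s) x).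
Proof.
move=> nSx; set U := connected_component _ x.
have So : open (~` boundary s) by apply: closed_openC; exact: boundary_closed.
suff <- : boundary s `&` closure U = boundary s by move=> y [].
apply: boundary_connected; last first.
- by exists (closure U) => //; exact: closed_closure.
- exists ((closure U `|` ~` boundary s)°); first exact: open_interior.
  apply/seteqP; split=> z [Sz].
    move=> Uz; split=> //; have [e e0 he] := boundary_local Sz.
    have [y [Uy zy]] := Uz _ (nbhsx_ballx z e e0).
    apply/nbhs_ballP; exists e => //= w zw.
    have [Sw|] := pselect (boundary s w); [left|by right].
    rewrite /U (same_connected_component Uy); apply: (he y w) => //.
    exact: (connected_component_sub Uy).
  by move=> /interior_subset[|].
(* If the closure of [U] missed the boundary, [U] would be open and closed in the plane, and the
   segment from [x] to a vertex could not leave it. *)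
apply/set0P/eqP => SU0.
have Uc : closed U.
  move=> y Uy; have nSy : ~ boundary s y.
    by move=> Sy; have : (boundary s `&` closure U) y by []; rewrite SU0.
  have [w [Uw yw]] := Uy _ (open_nbhs_nbhs
    (conj (@component_open K _ y So) (connected_component_refl nSy))).
  rewrite /U (same_connected_component Uw).
  exact: connected_component_sym.
have Uo : open U by exact: component_open.
have S0 : boundary s s`_0 by exists 0%N; [rewrite /=; lia | exact: segment_l].
have Ux : U x by exact: connected_component_refl.
have sE : segment x s`_0 `&` U = segment x s`_0.
  apply: segment_set_connected; last by exists U.
    by exists x; split=> //; exact: segment_l.
  by exists U.
have : (segment x s`_0 `&` U) s`_0 by rewrite sE; exact: segment_r.
by move=> [_ /connected_component_sub].
Qed.

End PolygonBoundary.

(** * Polygons trapped in triangles and triangles in polygons *)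

Section TrappedPolygons.
Variable K : realType.
Implicit Types (X Y A B C c y : K * K) (s : seq (K * K)).

Lemma solid_sub_tri_set s X A B y : simple_polygon s -> 0 < orient A B X ->
  tri_set X A B y -> inside s y -> inside s `&` perimeter X A B = set0 ->
  solid s `<=` tri_set X A B.
Proof.
move=> ss p0 Dy [nSy bU] inP0; set D := tri_set X A B.
have UD : connected_component (~` boundary s) y `<=` D.
  apply: connected_trapped => //; first exact: component_connected.
    by exists y; split=> //; exact: connected_component_refl.
  rewrite -subset0 -inP0 => z [Uz Pz]; split=> //; split.
    exact: (connected_component_sub Uz).
  by rewrite -(same_connected_component Uz).
have SD : boundary s `<=` D.
  move=> z /(boundary_sub_closure ss nSy) Uz.
  by apply: (tri_set_closed p0); apply: closureS Uz.
(* A point of [inside s] off the triangle would be beyond the line of one side, in an open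
   half-plane free of the boundary, and its component would be unbounded. *)
move=> z [/SD//|[nSz bz]]; apply: contrapT => nDz.
have far P Q : orient P Q z < 0 -> (forall w, D w -> 0 <= orient P Q w) -> False.
  move=> z0 HD; apply: (half_plane_unbounded z0 _ bz) => w /= w0 /SD/HD.
  by rewrite leNgt w0.
have DE := fun w => (tri_set_orient w p0).1.
have [h1|h1] := ltP (orient A B z) 0; first by apply: (far A B) => // w /DE[].
have [h2|h2] := ltP (orient B X z) 0; first by apply: (far B X) => // w /DE[].
have [h3|h3] := ltP (orient X A z) 0; first by apply: (far X A) => // w /DE[].
by apply: nDz; apply/tri_set_orient.
Qed.

(** A point of the triangle outside [solid s] has an unbounded component; this component avoids the
    perimeter, so it would be trapped in the triangle. *)
Lemma tri_set_sub_solid s X A B : 0 < orient A B X ->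
  perimeter X A B `<=` solid s -> tri_set X A B `<=` solid s.
Proof.
move=> p0 PS y Dy; apply: contrapT => nSy.
have nBy : ~ boundary s y by move=> By; apply: nSy; left.
apply: nSy; right; split=> //; apply: contrapT => nb.
apply: (nb); have [M HM] := bounded_set_ex (tri_set_bounded X A B).
apply: (@bounded_set_le _ _ M) => z Uz; apply: HM; move: z Uz.
apply: connected_trapped => //; first exact: component_connected.
  by exists y; split=> //; exact: connected_component_refl.
rewrite -subset0 => z [Uz /PS[Bz|[_ bz]]]; first exact: (connected_component_sub Uz).
by apply: nb; rewrite (same_connected_component Uz).
Qed.

(** The centroid is interior; halving the radius of a sup-norm ball around it leaves room for a
    closed Euclidean disc. *)
Lemma tri_set_disc X A B : 0 < orient A B X ->
  exists c rho, 0 < rho /\ closed_disc c rho `<=` tri_set X A B.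
Proof.
move=> p0; pose c : K * K := 3^-1 *: X + 3^-1 *: A + 3^-1 *: B.
have e1 : 3^-1 + 3^-1 + 3^-1 = 1 :> K by field.
have : nbhs c [set y | [/\ 0 < orient A B y, 0 < orient B X y & 0 < orient X A y]].
  have pos P Q : 0 < orient P Q X + orient P Q A + orient P Q B ->
      nbhs c [set y | 0 < orient P Q y].
    move=> h; apply: open_nbhs_nbhs; split; first exact: orient_gt0_open.
    by rewrite /= /c orient_comb // -!mulrDr mulr_gt0 // invr_gt0.
  have z P Q : orient P Q P = 0 by rewrite /orient; ring.
  have z' P Q : orient P Q Q = 0 by rewrite /orient; ring.
  have h1 := pos A B; have h2 := pos B X; have h3 := pos X A.
  rewrite !z !z' !addr0 -?(orient_rot A B X) in h1.
  rewrite !z !z' addr0 add0r -(orient_rot A B X) in h2.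
  rewrite !z !z' !add0r -(orient_rot B X A) -(orient_rot A B X) in h3.
  by near=> y; split; near: y; [exact: h1 | exact: h2 | exact: h3].
move=> /nbhs_ballP[e /= e0 he]; exists c, (e / 2); split; first by rewrite divr_gt0.
move=> y; rewrite /closed_disc /= edist_le; last by rewrite divr_ge0 // ltW.
move=> h; apply/tri_set_orient => //.
suff /he[] : ball c e y by split; exact: ltW.
have key (u v : K) : u ^+ 2 + v ^+ 2 <= (e / 2) ^+ 2 -> `|u| < e.
  move=> uv; have : `|u| <= e / 2.
    rewrite -(@ler_pXn2r _ 2) // ?nnegrE //; last by rewrite divr_ge0 // ltW.
    by rewrite real_normK ?num_real //; apply: le_trans uv; rewrite lerDl sqr_ge0.
  by move/le_lt_trans; apply; lra.
by apply/ball_coord; split; [apply: key h | apply: key; rewrite addrC; exact: h].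
Unshelve. all: by end_near. Qed.

(** The hull contains a triangle on three non-collinear vertices, hence a disc. The cubic is
    positive at 0 because of this. *)
Lemma irch_gt0 s delta : simple_polygon s -> is_irch s delta -> 0 < delta.
Proof.
move=> ss [_ _ dmax].
have n3 : (3 <= size s)%N by case: ss.
have [j lj nj] := not_collinear ss.
suff [c [rho [rho0 sub]]] : exists c rho, 0 < rho /\
    closed_disc c rho `<=` conv_hull (solid s).
  exact: lt_le_trans rho0 (dmax c rho (ltW rho0) sub).
have sol i : (i < size s)%N -> conv_hull (solid s) s`_i.
  by move=> li; apply: sub_conv_hull; left; exists i => //; exact: segment_l.
have triS A B C : conv_hull (solid s) A -> conv_hull (solid s) B ->
    conv_hull (solid s) C -> 0 < orient A B C -> exists c rho, 0 < rho /\
    closed_disc c rho `<=` conv_hull (solid s).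
  move=> sA sB sC /tri_set_disc[c [rho [rho0 sub]]]; exists c, rho; split=> //.
  by apply: subset_trans sub _; apply: tri_set_min => //; exact: conv_hull_convex.
have s0 := sol 0%N ltac:(lia); have s1 := sol _ (next_index_lt ss (i := 0%N) ltac:(lia)).
have [pos|neg] := ltP 0 (orient s`_0 (next_vertex s 0) s`_j).
  by apply: (triS _ _ _ s0 s1 (sol j lj)).
apply: (triS _ _ _ s1 s0 (sol j lj)).
by rewrite orient_swap oppr_gt0 lt_neqAle nj.
Qed.

Lemma perimeterC X A B : perimeter X A B = perimeter X B A.
Proof. by rewrite /perimeter [segment A B]segmentC [segment X A `|` _]setUC. Qed.

Lemma tri_set_sub_region b (L : layout K b) (delta : 'I_b -> K) r R X A B :
  wf_layout L -> 0 < r -> admissible r delta R ->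
  (forall k, is_irch (obstacle L k) (delta k)) ->
  orient A B X != 0 -> perimeter X A B `<=` region L ->
  edist X A + edist X B < 2 * r -> edist A B <= R ->
  tri_set X A B `<=` region L.
Proof.
wlog p0 : A B / 0 < orient A B X.
  move=> hw wf r0 adm irch n0 per lt2r leR.
  have [p0|p0] := ltP 0 (orient A B X); first exact: (hw A B).
  have p1 : 0 < orient B A X by rewrite orient_swap oppr_gt0 lt_neqAle n0.
  apply: (subset_trans (@tri_setC _ X A B)).
  apply: (hw B A) => //; first by rewrite gt_eqF.
  - by rewrite -perimeterC.
  - by rewrite addrC.
  - by rewrite edistC.
move=> wf r0 adm irch n0 per lt2r leR y Dy; have [sw so subw _] := wf.
split.
  by apply: (tri_set_sub_solid p0 _ Dy) => z /per[].
move=> [k _ ink].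
have sol : conv_hull (solid (obstacle L k)) `<=` tri_set X A B.
  apply: conv_hull_min; first exact: tri_set_convex.
  apply: (solid_sub_tri_set (so k) p0 Dy ink).
  by rewrite -subset0 => z [inz /per[_]]; apply; exists k.
(* The obstacle [k] makes the index set nonempty, so the minimum exists; the disc of radius
   [delta k] in the hull of [k] contains the concentric one of radius [delta m]. *)
have [m _ mmin] := arg_minP delta (erefl : xpredT k).
have dm : is_min delta (delta m) by split=> [|l]; [exists m | exact: mmin].
have dm0 : 0 < delta m by exact: irch_gt0 (so m) (irch m).
have [_ [c disc] _] := irch k.
apply: (@no_large_inscribed_disc _ X A B c (delta m) r R) => //.
  by move=> x x0 xR; exact: (admissible_bound r0 adm dm).
move=> z zc; suff : closed_disc c (delta k) z by move/disc/sol.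
by rewrite /closed_disc /=; apply: le_trans (mmin k isT); exact: zc.
Qed.

End TrappedPolygons.

(** * Visibility from every point of a triangle *)

Section VisibleTriangle.
Variables (K : realType) (b : nat) (L : layout K b) (delta : 'I_b -> K) (r R : K).
Hypotheses (wf : wf_layout L) (r0 : 0 < r) (adm : admissible r delta R)
  (irch : forall k, is_irch (obstacle L k) (delta k)).
Implicit Types (A B C X Q y : K * K).

Lemma tri_set_split X A B t y : 0 < t -> t < 1 -> tri_set X A B y ->
  tri_set X A (lin A B t) y \/ tri_set X (lin A B t) B y.
Proof.
move=> t0 t1 [x [a [c [x0 a0 c0 e ->]]]].
have u0 : 0 < 1 - t by rewrite subr_gt0.
(* The line from [X] through the point meets [AB] at parameter [c / (a + c)], which is compared here
   with [t]. *)
have [h|h] := leP (c * (1 - t)) (a * t); [left|right].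
  exists x, (a - c / t * (1 - t)), (c / t); split=> //.
  - rewrite subr_ge0 -(ler_pM2r t0); apply: le_trans h.
    by rewrite mulrAC divfK ?gt_eqF.
  - by rewrite divr_ge0 // ltW.
  - by rewrite -[RHS]e; field; rewrite gt_eqF.
  by apply: point_eq; rewrite /= /GRing.scale /=; field; rewrite gt_eqF.
exists x, (a / (1 - t)), (c - a / (1 - t) * t); split=> //.
- by rewrite divr_ge0 // ltW.
- rewrite subr_ge0 -(ler_pM2r u0) mulrAC divfK ?gt_eqF //; exact: ltW.
- by rewrite -[RHS]e; field; rewrite gt_eqF.
by apply: point_eq; rewrite /= /GRing.scale /=; field; rewrite gt_eqF.
Qed.

(* As [ga < 0], the line [AB] separates [C] from [X]. If [be <= 0] (resp.
   [al <= 0]) then [A] (resp. [B]) lies in the triangle spanned by [X], [C] and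
   the other endpoint, and not on the side opposite to [X]; otherwise [XC] meets
   [AB] at a point [D] before reaching [C], and [XAB] is cut along [XD]. Either
   way some leg is shorter than [r], which excludes the borderline case [R = 2x*]. *)
Lemma far_side_sub_region A B C X (al be ga : K) : orient A B C != 0 ->
  al + be + ga = 1 -> ga < 0 -> X = al *: A + be *: B + ga *: C ->
  segment X A `<=` region L -> segment X B `<=` region L ->
  segment X C `<=` region L -> segment A B `<=` region L ->
  edist X A <= r -> edist X B <= r -> edist X C <= r -> edist A B <= R ->
  tri_set X A B `<=` region L.
Proof.
move=> nABC sum1 ga0 XE sXA sXB sXC sAB dXA dXB dXC dAB.
have nABX : orient A B X != 0.
  have -> : orient A B X = ga * orient A B C.
    by rewrite XE orient_comb // /orient; ring.
  by rewrite mulf_neq0 // lt_eqF.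
have [be0|be0] := leP be 0.
  have al0 : 0 < al by lra.
  have ltA : edist X A < r.
    apply: (@edist_shrink _ A B C X r (- be / al) (- ga / al)) => //.
    - by rewrite divr_ge0 ?oppr_ge0 // ltW.
    - by rewrite divr_ge0 ?oppr_ge0 // ltW.
    - by rewrite -mulrDl ltr_pdivrMr //; lra.
    have aE : al = 1 - be - ga by lra.
    have an : 1 - be - ga != 0 by rewrite -aE gt_eqF.
    by rewrite XE aE; apply: point_eq; rewrite /= /GRing.scale /=; field.
  apply: (tri_set_sub_region wf r0 adm irch nABX) => //; last lra.
  by move=> y [[|]|]; [exact: sXA | exact: sXB | exact: sAB].
have [al0|al0] := leP al 0.
  have ltB : edist X B < r.
    apply: (@edist_shrink _ B A C X r (- al / be) (- ga / be)) => //.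
    - by rewrite divr_ge0 ?oppr_ge0 // ltW.
    - by rewrite divr_ge0 ?oppr_ge0 // ltW.
    - by rewrite -mulrDl ltr_pdivrMr //; lra.
    have bE : be = 1 - al - ga by lra.
    have bn : 1 - al - ga != 0 by rewrite -bE gt_eqF.
    by rewrite XE bE; apply: point_eq; rewrite /= /GRing.scale /=; field.
  apply: (tri_set_sub_region wf r0 adm irch nABX) => //; last lra.
  by move=> y [[|]|]; [exact: sXA | exact: sXB | exact: sAB].
pose t := be / (al + be); pose D := lin A B t.
have ab0 : 0 < al + be by lra.
have abn : al + be != 0 by rewrite gt_eqF.
have t0 : 0 < t by rewrite divr_gt0.
have t1 : t < 1 by rewrite ltr_pdivrMr // mul1r; lra.
(* Solving [XE] for the point of [AB] places [D] on [XC], strictly before [C]. *)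
have DE : D = (1 - 0 - - ga / (al + be)) *: X + 0 *: A + (- ga / (al + be)) *: C.
  have gE : ga = 1 - al - be by lra.
  by rewrite XE /D /t gE; apply: point_eq; rewrite /= /GRing.scale /=; field.
have g0 : 0 <= - ga / (al + be) by rewrite divr_ge0 ?oppr_ge0 // ltW.
have g1 : - ga / (al + be) < 1 by rewrite ltr_pdivrMr // mul1r; lra.
have ltD : edist X D < r.
  by apply: (@edist_shrink _ D A C X r 0 (- ga / (al + be))); rewrite ?add0r.
have XDC : segment X D `<=` segment X C.
  apply: segment_seg_convex; first exact: segment_l.
  exists (- ga / (al + be)); first by rewrite /= g0 ltW.
  by rewrite DE subr0 scale0r addr0.
have Dseg : segment A B D by exists t => //; rewrite /= !ltW.
have sAD : segment A D `<=` segment A B.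
  by apply: segment_seg_convex => //; exact: segment_l.
have sDB : segment D B `<=` segment A B.
  by apply: segment_seg_convex => //; exact: segment_r.
have R0 : 0 <= R by apply: le_trans dAB; exact: edist_ge0.
have ee P : edist P P = 0 by rewrite /edist !subrr expr0n addr0 sqrtr0.
have dAD : edist A D <= R.
  (* The segment [AB] is treated as the degenerate triangle [AAB]. *)
  rewrite edistC; apply: (@edist_tri_set _ A A B) => //; rewrite ?ee //.
    exact: (tri_set_convex (@tri_set2 _ A A B) (@tri_set3 _ A A B) Dseg).
  by rewrite edistC.
have dDB : edist D B <= R.
  apply: (@edist_tri_set _ A A B) => //; rewrite ?ee //.
  exact: (tri_set_convex (@tri_set2 _ A A B) (@tri_set3 _ A A B) Dseg).
move=> y /(tri_set_split t0 t1)[]; move: y.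
  apply: (tri_set_sub_region wf r0 adm irch) => //; last lra.
    have -> : orient A D X = t * orient A B X.
      by rewrite /D /orient /= /GRing.scale /=; ring.
    by rewrite mulf_neq0 // gt_eqF.
  move=> y [[|]|]; [exact: sXA | by move/XDC; exact: sXC | by move/sAD; exact: sAB].
apply: (tri_set_sub_region wf r0 adm irch) => //; last lra.
  have -> : orient D B X = (1 - t) * orient A B X.
    by rewrite /D /orient /= /GRing.scale /=; ring.
  by rewrite mulf_neq0 // gt_eqF // subr_gt0.
by move=> y [[|]|]; [by move/XDC; exact: sXC | exact: sXB | by move/sDB; exact: sAB].
Qed.

(** A point moving linearly from the positive octant either stays in it up to time [t] or is stopped
    at the first time [s] when a decreasing coordinate reaches 0. *)
Lemma slide (a1 a2 a3 c1 c2 c3 t : K) : 0 <= a1 -> 0 <= a2 -> 0 <= a3 -> 0 <= t ->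
  [/\ 0 <= a1 + t * c1, 0 <= a2 + t * c2 & 0 <= a3 + t * c3] \/
  exists s, [/\ 0 <= s, s <= t,
    0 <= a1 + s * c1, 0 <= a2 + s * c2 & 0 <= a3 + s * c3] /\
    [\/ c1 < 0 /\ a1 + s * c1 = 0, c2 < 0 /\ a2 + s * c2 = 0 |
        c3 < 0 /\ a3 + s * c3 = 0].
Proof.
move=> a10 a20 a30 t0.
(* The time at which a coordinate vanishes, with default [t] if it does not decrease; a minimum
   below [t] thus comes from a decreasing coordinate. *)
pose m (a c : K) := if c < 0 then - a / c else t.
have mge0 a c : 0 <= a -> 0 <= m a c.
  move=> a0; rewrite /m; case: ifP => // c0.
  by rewrite mulNr -mulrN -invrN divr_ge0 // oppr_ge0 ltW.
have ok a c s : 0 <= a -> 0 <= s -> s <= m a c -> 0 <= a + s * c.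
  rewrite /m => a0 s0; case: ltP => c0; last by move=> _; rewrite addr_ge0 ?mulr_ge0.
  by rewrite ler_ndivlMr // => h; lra.
have hit a c : m a c < t -> c < 0 /\ a + m a c * c = 0.
  rewrite /m; case: (ltP c 0) => [c0 _|_]; last by rewrite ltxx.
  by rewrite divfK ?lt_eqF // subrr.
pose s := Num.min (m a1 c1) (Num.min (m a2 c2) (m a3 c3)).
have s1 : s <= m a1 c1 by rewrite ge_min lexx.
have s2 : s <= m a2 c2 by rewrite !ge_min lexx orbT.
have s3 : s <= m a3 c3 by rewrite !ge_min lexx !orbT.
have s0 : 0 <= s by rewrite !le_min !mge0.
have [ts|st] := leP t s.
  by left; split; apply: ok => //; apply: le_trans ts _.
right; exists s; split; first by split; rewrite ?ok // ltW.
have : [\/ s = m a1 c1, s = m a2 c2 | s = m a3 c3].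
  rewrite /s /Num.min; case: ifP => _; first by constructor 1.
  by case: ifP => _; [constructor 2 | constructor 3].
by case=> sE; move: st; rewrite sE => /hit h; [constructor 1|constructor 2|constructor 3].
Qed.

(** In [lin Q X t], a part [s] of the weight [t] of [X] is expanded in the barycentric coordinates
    of [X], the rest being kept as [(t - s) *: X]. As [s] grows, either all coordinates stay
    nonnegative up to [t] and the point is in [ABC], or one with a negative coefficient in [X]
    vanishes. The point then lies in the triangle from [X] over the opposite side, which separates
    [X] from the third vertex, and [far_side_sub_region] applies. *)
Lemma visible_triangle A B C X Q : orient A B C != 0 ->
  tri_set A B C `<=` region L ->
  segment A X `<=` region L -> segment B X `<=` region L ->
  segment C X `<=` region L ->
  edist A X <= r -> edist B X <= r -> edist C X <= r ->
  edist A B <= R -> edist B C <= R -> edist C A <= R ->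
  tri_set A B C Q -> segment Q X `<=` region L.
Proof.
move=> n0 sub sA sB sC dA dB dC dAB dBC dCA DQ _ [t /andP[t0 t1] <-].
rewrite segmentC in sA; rewrite segmentC in sB; rewrite segmentC in sC.
rewrite edistC in dA; rewrite edistC in dB; rewrite edistC in dC.
pose al := orient B C X / orient A B C; pose be := orient C A X / orient A B C.
pose ga := orient A B X / orient A B C.
have XE : X = al *: A + be *: B + ga *: C by exact: orient_barycentric.
have sum1 : al + be + ga = 1 by rewrite -!mulrDl orient_sum divff.
clearbody al be ga.
have [n1 n2] : orient B C A != 0 /\ orient C A B != 0.
  by rewrite -(orient_rot B C A) -(orient_rot A B C).
have sABC P Q' : tri_set A B C P -> tri_set A B C Q' -> segment P Q' `<=` region L.
  by move=> hP hQ; apply: subset_trans sub; exact: tri_set_convex.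
have tA := @tri_set1 _ A B C; have tB := @tri_set2 _ A B C.
have tC := @tri_set3 _ A B C.
have [a1 [a2 [a3 [a10 a20 a30 e QE]]]] := DQ.
pose u := 1 - t; have u0 : 0 <= u by rewrite /u; lra.
have [[h1 h2 h3]|[s [[s0 st h1 h2 h3] hit]]] :=
  slide al be ga (mulr_ge0 u0 a10) (mulr_ge0 u0 a20) (mulr_ge0 u0 a30) t0.
  apply: sub; exists (u * a1 + t * al), (u * a2 + t * be), (u * a3 + t * ga).
  split=> //.
    have -> : u * a1 + t * al + (u * a2 + t * be) + (u * a3 + t * ga) =
      u * (a1 + a2 + a3) + t * (al + be + ga) by ring.
    by rewrite e sum1 /u; ring.
  by rewrite QE {1}XE /lin -/u; apply: point_eq; rewrite /= /GRing.scale /=; ring.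
have yE : lin Q X t = (t - s) *: X + (u * a1 + s * al) *: A +
    (u * a2 + s * be) *: B + (u * a3 + s * ga) *: C.
  have -> : lin Q X t = u *: Q + (t - s) *: X + s *: X.
    by apply: point_eq; rewrite /= /GRing.scale /= /u; ring.
  by rewrite {2}XE QE; apply: point_eq; rewrite /= /GRing.scale /=; ring.
have ysum : (t - s) + (u * a1 + s * al) + (u * a2 + s * be) + (u * a3 + s * ga) = 1.
  have -> : (t - s) + (u * a1 + s * al) + (u * a2 + s * be) + (u * a3 + s * ga) =
    t - s + u * (a1 + a2 + a3) + s * (al + be + ga) by ring.
  by rewrite e sum1 /u; ring.
rewrite yE; case: hit => [[c0 z]|[c0 z]|[c0 z]].
- apply: (@far_side_sub_region B C A X be ga al) => //.
  + by rewrite -sum1; ring.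
  + by rewrite XE; apply: point_eq; rewrite /= /GRing.scale /=; ring.
  + exact: sABC.
  + rewrite z scale0r addr0; exists (t - s), (u * a2 + s * be), (u * a3 + s * ga).
    by split=> //; [rewrite subr_ge0 | rewrite -ysum z; ring].
- apply: (@far_side_sub_region C A B X ga al be) => //.
  + by rewrite -sum1; ring.
  + by rewrite XE; apply: point_eq; rewrite /= /GRing.scale /=; ring.
  + exact: sABC.
  + rewrite z scale0r addr0; exists (t - s), (u * a3 + s * ga), (u * a1 + s * al).
    split=> //; [by rewrite subr_ge0 | by rewrite -ysum z; ring |].
    by rewrite addrAC.
- apply: (@far_side_sub_region A B C X al be ga) => //.
  + exact: sABC.
  + rewrite z scale0r addr0; exists (t - s), (u * a1 + s * al), (u * a2 + s * be).
    by split=> //; [rewrite subr_ge0 | rewrite -ysum z; ring].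
Qed.

End VisibleTriangle.

(** * Coverage is preserved by bisection *)

Section Bisection.
Variable K : realType.
Implicit Types (A B C P : K * K) (p : triangle K) (ts us : seq (triangle K)).
Implicit Types S : set (K * K).

Lemma nondegenerateE p A B C : p = [:: A; B; C] :> seq _ ->
  nondegenerate p = (orient A B C != 0).
Proof. by move=> pE; rewrite /nondegenerate pE. Qed.

(* Twice the signed area is the determinant of the matrix with rows
   [(1, P.1, P.2)]; its square is the Gram determinant of the columns, which
   does not depend on the order of the vertices. *)
Lemma orient_sqr_gram A B C (s := [:: A; B; C]) :
  let m f := \sum_(P <- s) f P in
  orient A B C ^+ 2 =
    3 * (m (fun P => P.1 ^+ 2) * m (fun P => P.2 ^+ 2) -
         m (fun P => P.1 * P.2) ^+ 2) -
    m fst * (m fst * m (fun P => P.2 ^+ 2) - m (fun P => P.1 * P.2) * m snd) +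
    m snd * (m fst * m (fun P => P.1 * P.2) - m (fun P => P.1 ^+ 2) * m snd).
Proof. by rewrite /= /s !big_cons !big_nil /orient; ring. Qed.

Lemma orient_perm A B C A' B' C' : perm_eq [:: A; B; C] [:: A'; B'; C'] ->
  orient A B C != 0 -> orient A' B' C' != 0.
Proof.
move=> pm; rewrite -sqrf_eq0 -[X in _ -> X != 0]/(orient A' B' C').
by rewrite -[orient A' _ _ == 0]sqrf_eq0 !orient_sqr_gram /= !(perm_big _ pm).
Qed.

(** The invariant of the induction along [iter_bisection]. *)
Definition triangles_cover S ts : Prop :=
  (forall p, p \in ts -> nondegenerate p /\ tri_region p `<=` S) /\
  forall Q, S Q -> exists2 p, p \in ts & tri_region p Q.

Lemma triangleE p : exists A B C, p = [:: A; B; C] :> seq _.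
Proof. by case: p => -[|A [|B [|C [|? ?]]]] //= ?; exists A, B, C. Qed.

(** A median halves the signed area, so both halves are nondegenerate; they lie in the old triangle
    by convexity and cover it by [tri_set_split]. *)
Lemma bisection_cover S ts us : bisection ts us ->
  triangles_cover S ts -> triangles_cover S us.
Proof.
move=> [p [vs [A [B [C [pts pABC _ pus]]]]]] [sub cov].
have pin : p \in ts by rewrite (perm_mem pts) mem_head.
have vsin q : q \in vs -> q \in ts by move=> qv; rewrite (perm_mem pts) inE qv orbT.
have [nd psub] := sub p pin.
have pE : tri_region p = tri_set A B C by apply/tri_regionE/perm_mem.
have nABC : orient A B C != 0.
  have [A' [B' [C' pE']]] := triangleE p.
  move: nd; rewrite (nondegenerateE pE'); apply: orient_perm.
  by rewrite -pE'.
set M := midpoint A B.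
have MAB : segment A B M.
  by exists 2^-1 => //; rewrite /= invr_ge0 ler0n invf_le1 // ler1n.
have DM : tri_set A B C M.
  by apply: (tri_set_convex (@tri_set1 _ A B C) (@tri_set2 _ A B C)).
have r1 : tri_region [tuple A; M; C] = tri_set A M C by exact: tri_regionE.
have r2 : tri_region [tuple M; B; C] = tri_set M B C by exact: tri_regionE.
split.
  move=> q; rewrite (perm_mem pus) !inE => /or3P[/eqP ->|/eqP ->|/vsin/sub //].
    rewrite r1 (@nondegenerateE _ A M C) //; split.
      have -> : orient A M C = 2^-1 * orient A B C.
        by rewrite /M /orient /= /GRing.scale /=; field.
      by rewrite mulf_neq0 // invr_eq0 pnatr_eq0.
    apply: subset_trans psub; rewrite pE; apply: tri_set_min => //.
    - exact: tri_set_convex.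
    - exact: tri_set1.
    - exact: tri_set3.
  rewrite r2 (@nondegenerateE _ M B C) //; split.
    have -> : orient M B C = 2^-1 * orient A B C.
      by rewrite /M /orient /= /GRing.scale /=; field.
    by rewrite mulf_neq0 // invr_eq0 pnatr_eq0.
  apply: subset_trans psub; rewrite pE; apply: tri_set_min => //.
  - exact: tri_set_convex.
  - exact: tri_set2.
  - exact: tri_set3.
move=> Q /cov[q]; rewrite (perm_mem pts) inE => /predU1P[->|qvs] Qq; last first.
  by exists q => //; rewrite (perm_mem pus) !inE qvs !orbT.
have h0 : 0 < 2^-1 :> K by rewrite invr_gt0.
have h1 : 2^-1 < 1 :> K by rewrite invf_lt1 // ltr1n.
(* [tri_set_split] cuts from the apex, so [C] is rotated into first place. *)
have CAB : tri_set C A B Q by do 2 apply: tri_setR; rewrite -pE.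
have [h|h] := tri_set_split h0 h1 CAB.
  exists [tuple A; M; C]; first by rewrite (perm_mem pus) mem_head.
  by rewrite r1; apply: tri_setR.
exists [tuple M; B; C]; first by rewrite (perm_mem pus) in_cons mem_head orbT.
by rewrite r2; apply: tri_setR.
Qed.

Lemma hyper_triangulation_cover R b (L : layout K b) ts :
  hyper_triangulation R L ts -> triangles_cover (region L) ts.
Proof.
move=> [ts0 [[ndeg reg _ _] it _]].
have : triangles_cover (region L) ts0.
  split=> [p pts|Q]; last by rewrite reg => -[p pts Qp]; exists p.
  by split; [have [] := ndeg p pts | rewrite reg => Q Qp; exists p].
elim: it => // us vs ws _ IH uv /IH; exact: bisection_cover.
Qed.

End Bisection.

(** * From the clique cover to line-of-sight coverage *)

Theorem theorem1 (K : realType) (r : K) (hr : 0 < r)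
    (b T : nat) (hT : (0 < T)%N)
    (L : 'I_T -> layout K b) (hL : realizations L)
    (delta : 'I_b -> K)
    (hdelta : forall t k, is_irch (obstacle (L t) k) (delta k))
    (R : K) (hR : admissible r delta R)
    (M : 'I_T -> nat) (p : forall t : 'I_T, (M t).-tuple (triangle K))
    (hp : forall t, hyper_triangulation R (L t) (p t))
    (g : nat) (c : 'I_g -> {set pv_node M})
    (hpart : partitioned_by c)
    (hclique : forall j, clique (pv_edge L r p) (c j))
    (hvis : forall j, nodes_vis L r p (c j) !=set0)
    (X : 'I_g -> K * K) (hX : forall j, nodes_vis L r p (c j) (X j)) :
  forall (t : 'I_T) (Q : K * K), region (L t) Q ->
    exists j, vis_point (L t) r Q (X j).
Proof.
move=> t Q LQ.
have [sub cov] := hyper_triangulation_cover (hp t).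
have [q qp Qq] := cov Q LQ.
have [i qE] := tnthP _ _ qp.
(* The node of [q] lies in some [c j], so [X j] sees all three vertices of [q] in [L t], within
   range. *)
pose v : pv_node M := Tagged (fun t => 'I_(M t)) i.
have [inj /cover_partition vcov] := hpart.
have /bigcupP[_ /imsetP[j _ ->] vj] : v \in finset.cover (c @: finset.setT)%SET.
  by rewrite vcov finset.in_setT.
exists j.
have vis P : P \in q -> vis_point (L t) r P (X j).
  by rewrite qE => Pq; exact: (hX j v vj P Pq).
have [A [B [C qABC]]] := triangleE q.
have memq : q =i [:: A; B; C] by move=> P; rewrite -qABC.
have [ndq qsub] := sub q qp.
have [_ [_ _ side]] := hp t.
have qE' := tri_regionE memq.
have [qA qB qC] : [/\ A \in q, B \in q & C \in q].
  by rewrite !memq !inE !eqxx !orbT.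
have [sA dA] := vis A qA; have [sB dB] := vis B qB; have [sC dC] := vis C qC.
have DQ : tri_set A B C Q by rewrite -qE'.
(* The range at [Q] comes from convexity of the distance to [X j], the line of sight from
   [visible_triangle], fed with the side bound [R]. *)
split; last exact: edist_tri_set (ltW hr) DQ dA dB dC.
apply: (visible_triangle (hL.1 t) hr hR (hdelta t) _ _ sA sB sC dA dB dC) DQ.
- by rewrite -(nondegenerateE qABC).
- by rewrite -qE'.
- exact: (side q).
- exact: (side q).
- exact: (side q).
Qed.
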